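(* Let $0<q<1$ and let $w:(0,1]\to(0,\infty)$ be a function such that $\sum_{k=0}^\infty q^k w(q^k)<\infty$. Let $p_n(x)=\gamma_n x^n+\cdots$ ($\gamma_n>0$, $n=0,1,2,\ldots$) be the orthonormal polynomials on the lattice $\{q^k: k=0,1,2,\ldots\}$ with weight $w$, i.e. \[ \sum_{k=0}^\infty p_n(q^k)p_m(q^k)\,q^k w(q^k)=\delta_{n,m},\qquad n,m\ge 0, \] and let $x_{1,n}<x_{2,n}<\cdots<x_{n,n}$ be the zeros of $p_n$ (which are simple and lie in $(0,1)$). Suppose that \[ \lim_{n\to\infty}\frac{-1}{n^2}\log w(x^n)=2Q(x) \] uniformly for $x$ in every closed interval $[a,b]$ with $0<a<b\le1$, where $Q$ is an admissible external field on $[0,1]$ which is decreasing on $(0,\delta]$ for some $\delta>0$. Then \[ \lim_{n\to\infty}\gamma_n^{1/n^2}=e^{w_Q^\sigma}, \] and the asymptotic distribution of the roots $x_{1,n}^{1/n}<\cdots<x_{n,n}^{1/n}$ is given by the measure $\nu_Q^\sigma$, that is, for every continuous function $g$ on $[0,1]$, \[ \lim_{n\to\infty}\frac1n\sum_{j=1}^n g\bigl(x_{j,n}^{1/n}\bigr)=\int_0^1 g(t)\,d\nu_Q^\sigma(t). \] Here $\nu_Q^\sigma$ and $w_Q^\sigma$ are the radial part and the equilibrium constant of the constrained equilibrium measure $\mu_Q^\sigma$ with external field $Q$ and constraint $\sigma$, as defined in the context.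
   Context: Only the values $w(q^k)$ of $w$ on the lattice enter the orthogonality relation. Admissible field: $Q:[0,1]\to(-\infty,\infty]$ is an admissible external field on $[0,1]$ if $Q$ is lower semi-continuous on $[0,1]$ and the set $\{x\in[0,1]: Q(x)<\infty\}$ has positive logarithmic capacity. Constraint: $\sigma$ is the measure on $[0,1]$ with density $\sigma'(t)=\frac{-1}{\log q}\,\frac1t$, $t\in(0,1]$ (it has infinite total mass, but $\sigma([a,1])<\infty$ for every $0<a<1$). Circular symmetric measures: for a measure $\nu$ on $[0,1]$, $\hat\nu$ denotes the circular symmetric measure on the closed unit disk $\overline{\mathbb D}=\{z\in\mathbb C:|z|\le1\}$ given by \[ \int_{\overline{\mathbb D}} f\,d\hat\nu=\frac1{2\pi}\int_0^1\int_0^{2\pi}f(re^{i\theta})\,d\theta\,d\nu(r); \] $\nu$ is called the radial part of $\hat\nu$. Constrained equilibrium problem: let $U(z;\mu)=\int\log\frac1{|z-x|}\,d\mu(x)$ be the logarithmic potential and \[ I_Q(\mu)=\iint\log\frac1{|x-y|}\,d\mu(x)\,d\mu(y)+2\int Q(|x|)\,d\mu(x). \] The measure $\mu_Q^\sigma$ is the unique minimizer of $I_Q(\mu)$ over all circular symmetric probability measures $\mu=\hat\nu$ on $\overline{\mathbb D}$ whose radial part satisfies $\nu\le\sigma$; $\nu_Q^\sigma$ denotes its radial part. It is characterized by the variational inequalities \[ U(z;\mu_Q^\sigma)+Q(|z|)\ge w_Q^\sigma,\quad z\in\operatorname{supp}(\hat\sigma-\mu_Q^\sigma),\qquad U(z;\mu_Q^\sigma)+Q(|z|)\le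 w_Q^\sigma,\quad z\in\operatorname{supp}(\mu_Q^\sigma), \] where $w_Q^\sigma$ is a constant, called the equilibrium constant. *)

(* Defs.v *)
From HB Require Import structures.
From mathcomp Require Import all_boot all_order all_algebra.
From mathcomp Require Import all_classical all_reals all_analysis.
From mathcomp Require Import measurable_realfun.

Set Implicit Arguments.
Unset Strict Implicit.
Unset Printing Implicit Defensive.

Import Order.TTheory GRing.Theory Num.Theory.
Import numFieldNormedType.Exports.

Local Open Scope classical_set_scope.
Local Open Scope ring_scope.

(* The complex plane is R * R with its Borel sigma-algebra.  The library norm on
   R * R is the max norm (it induces the right topology), so the modulus has to
   be defined separately. *)
Notation cplane R := (measurableTypeR R * measurableTypeR R)%type.

Section plane.
Context {R : realType}.

Definition cabs (z : R * R) : R := Num.sqrt (z.1 ^+ 2 + z.2 ^+ 2).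

Definition closed_disk : set (cplane R) := [set z | cabs z <= 1].

Definition polar (u : cplane R) : cplane R := (u.1 * cos u.2, u.1 * sin u.2).

Lemma measurable_polar : measurable_fun setT polar.
Proof.
apply/measurable_fun_pairP; split => /=.
  apply: measurable_funM; first exact: measurable_fst.
  apply: measurableT_comp; last exact: measurable_snd.
  by apply: continuous_measurable_fun; exact: continuous_cos.
apply: measurable_funM; first exact: measurable_fst.
apply: measurableT_comp; last exact: measurable_snd.
by apply: continuous_measurable_fun; exact: continuous_sin.
Qed.

Lemma pi2_gt0 : 0 < 2 * pi :> R.
Proof. by rewrite mulr_gt0// pi_gt0. Qed.

Definition angle_prob := uniform_prob pi2_gt0.

HB.instance Definition _ := Probability.on angle_prob.

(* The circular symmetric measure with radial part nu: the law of
   r e^(i theta), with r distributed by nu and theta uniform on [0, 2 pi],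
   independent; see [ge0_integral_circ] for the integral formula. *)
Definition circ (nu : {measure set (measurableTypeR R) -> \bar R}) :
    set (cplane R) -> \bar R :=
  pushforward (nu \x angle_prob)%E polar.

Section circ_measure.
Variable nu : {measure set (measurableTypeR R) -> \bar R}.

Let circ0 : circ nu set0 = 0%E.
Proof. by rewrite /circ /pushforward preimage_set0 measure0. Qed.

Let circ_ge0 A : (0 <= circ nu A)%E.
Proof. by rewrite /circ /pushforward measure_ge0. Qed.

Let circ_sigma_additive : semi_sigma_additive (circ nu).
Proof.
move=> F mF tF mUF; rewrite /circ /pushforward preimage_bigcup.
have mp B : measurable B -> measurable (polar @^-1` B).
  by move=> mB; rewrite -[X in measurable X]setTI; exact: measurable_polar.
apply: measure_semi_sigma_additive.
- by move=> n; exact: mp.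
- apply/trivIsetP => /= i j _ _ ij; rewrite -preimage_setI.
  by move/trivIsetP : tF => /(_ _ _ _ _ ij) ->//; rewrite preimage_set0.
- by rewrite -preimage_bigcup; exact: mp.
Qed.

HB.instance Definition _ := isMeasure.Build _ _ _ (circ nu)
  circ0 circ_ge0 circ_sigma_additive.

End circ_measure.

Lemma ge0_integral_circ
    (nu : {sigma_finite_measure set (measurableTypeR R) -> \bar R})
    (f : cplane R -> \bar R) :
  measurable_fun setT f -> (forall z, 0 <= f z)%E ->
  (\int[circ nu]_z f z =
   \int[nu]_r ((2 * pi)^-1%:E *
     \int[lebesgue_measure]_(t in `[0%R, (2 * pi)%R])
        f (r * cos t, r * sin t)%R))%E.
Proof.
move=> mf f0; rewrite ge0_integral_pushforward//; last exact: measurable_polar.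
rewrite preimage_setT fubini_tonelli1//=; last first.
  by apply: measurableT_comp => //; exact: measurable_polar.
apply: eq_integral => r _; rewrite /fubini_F/= integral_uniform//=.
  by rewrite subr0.
apply: (measurableT_comp mf).
by apply: (measurableT_comp measurable_polar); exact: pair1_measurable.
Qed.

Definition log_potential (mu : {measure set (cplane R) -> \bar R})
    (z : cplane R) : \bar R :=
  (\int[mu]_x (- lne (cabs (z - x)%R)%:E))%E.

Definition log_energy (mu : {measure set (cplane R) -> \bar R}) : \bar R :=
  (\int[mu]_y log_potential mu y)%E.

Definition weighted_energy (Q : R -> \bar R)
    (mu : {measure set (cplane R) -> \bar R}) : \bar R :=
  (log_energy mu + 2%:E * \int[mu]_(x in closed_disk) Q (cabs x))%E.

(* exp (- V), with V the infimum of the energies of the probability measures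
   supported by a compact subset of E. *)
Definition log_capacity (E : set (R * R)) : \bar R :=
  expeR (- ereal_inf [set log_energy P | P in
    [set P : probability (cplane R) R |
      exists K : set (R * R), [/\ compact K, K `<=` E & P K = 1%E]]]).

Definition admissible_field (Q : R -> \bar R) : Prop :=
  [/\ forall x, 0 <= x <= 1 -> Q x != -oo%E,
      @lower_semicontinuous (subspace (`[0, 1]%classic : set R)) R Q &
      (0 < log_capacity
         [set z : R * R | [/\ z.2 = 0%R, (0 <= z.1 <= 1)%R & Q z.1 < +oo]])%E].

(* Stated for a set function, to be applied to a difference of measures. *)
Definition msupp (mu : set (cplane R) -> \bar R) : set (R * R) :=
  [set z | forall B : set (R * R), open B -> B z -> (0 < mu B)%E].

End plane.

Section constraint.
Context {R : realType}.

Definition constraint (q : R) (q01 : 0 < q < 1) :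
    set (measurableTypeR R) -> \bar R :=
  fun A => (\int[lebesgue_measure]_(t in A `&` `]0%R, 1%R])
              (- 1 / ln q * t^-1)%:E)%E.

Section constraint_measure.
Variables (q : R) (q01 : 0 < q < 1).

Let density : measurableTypeR R -> \bar R :=
  (fun t : R => (- 1 / ln q * t^-1)%:E) \_ `]0, 1].

Let constraintE A : constraint q01 A = (\int[lebesgue_measure]_(t in A) density t)%E.
Proof. by rewrite /constraint integral_mkcondr. Qed.

Let density_ge0 t : (0 <= density t)%E.
Proof.
rewrite /density patchE; case: ifPn => //.
rewrite inE /= in_itv/= => /andP[t0 _]; rewrite lee_fin.
rewrite mulr_ge0 ?invr_ge0 ?(ltW t0)// mulN1r oppr_ge0 invr_le0.
by case/andP: q01 => q0 q1; rewrite ltW// ln_lt0// q0.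
Qed.

Let measurable_density : measurable_fun setT density.
Proof.
apply/(measurable_restrictT _ _).1 => //; apply: measurableT_comp => //.
apply: measurable_funM => //.
apply: subspace_continuous_measurable_fun => //.
apply: continuous_in_subspaceT => t; rewrite inE /= in_itv/= => /andP[t0 _].
by apply: inv_continuous; rewrite gt_eqF.
Qed.

Let constraint0 : constraint q01 set0 = 0%E.
Proof. by rewrite constraintE integral_set0. Qed.

Let constraint_ge0 A : (0 <= constraint q01 A)%E.
Proof. by rewrite constraintE integral_ge0. Qed.

Let constraint_sigma_additive : semi_sigma_additive (constraint q01).
Proof.
rewrite (_ : constraint q01 = fun A => (\int[lebesgue_measure]_(t in A) density t)%E).
  exact: semi_sigma_additive_nng_induced.
by apply/funext => A; rewrite constraintE.
Qed.

HB.instance Definition _ := isMeasure.Build _ _ _ (constraint q01)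
  constraint0 constraint_ge0 constraint_sigma_additive.

(* Radial parts of the measures competing in the constrained problem. *)
Definition feasible (nu : probability (measurableTypeR R) R) : Prop :=
  nu `[0, 1]%classic = 1%E /\
  forall A, measurable A -> (nu A <= constraint q01 A)%E.

(* nu is the radial part of the constrained equilibrium measure [circ nu]. *)
Definition constrained_equilibrium (Q : R -> \bar R)
    (nu : probability (measurableTypeR R) R) : Prop :=
  feasible nu /\ forall nu', feasible nu' ->
    (weighted_energy Q (circ nu) <= weighted_energy Q (circ nu'))%E.

(* circ (constraint q01) is infinite near 0, but the subtrahend is finite and
   dominated, so the difference below is a measure. *)
Definition equilibrium_constant (Q : R -> \bar R)
    (nu : probability (measurableTypeR R) R) (c : R) : Prop :=
  (forall z, msupp (fun B => circ (constraint q01) B - circ nu B)%E z ->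
     (c%:E <= log_potential (circ nu) z + Q (cabs z))%E) /\
  (forall z, msupp (circ nu) z ->
     (log_potential (circ nu) z + Q (cabs z) <= c%:E)%E).

End constraint_measure.
End constraint.

(* Main.v *)
(* Write L = - ln q.  Replacing n by m n in the hypothesis on w gives Q(t^m) = m^2 Q(t), so
   Q is finite on (0,1], Q(1) = 0, monotonicity near 0 propagates to (0,1], and
   w(q^k) = exp(- 2 kappa k^2 + o(k^2)) with kappa = Q(q).

   Leading coefficients.  Extremality of p_n, tested against the monic polynomial with zeros
   1, q, ..., q^(n-1), bounds ln gamma_n from below by (kappa + L/2) n^2 - o(n^2).  Lagrange's
   formula at 1, ..., q^n together with p_n(q^k)^2 q^k w(q^k) <= 1 gives the matching upper
   bound.

   Zeros.  Two zeros of p_n are separated by a lattice point, so the j-th largest zero y_j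
   lies below q^j (j = 0, 1, ...).  At a node q^k dominating Lagrange's formula,
   - sum_j ln |q^k - y_j| <= (L/2) n^2 + o(n^2) and n - k = o(n), which leaves the y_j no room:
   the y_j^(1/n) are on average asymptotic to q^(j/n).

   Equilibrium.  Averaging the logarithmic kernel over angles gives min(- ln r, - ln s), which
   decreases in both radii, as Q does.  Hence mass should be pushed outwards as far as sigma
   allows, and the minimizer is sigma restricted to [q,1].  The circle |z| = q lies in both
   supports, where the two variational inequalities force the constant kappa + L/2; the
   measure is the limit of the averages over the points q^(j/n). *)
Require Import Defs.
From HB Require Import structures.
From mathcomp Require Import all_boot all_order all_algebra.
From mathcomp Require Import all_classical all_reals all_analysis.
From mathcomp Require Import measurable_realfun.
From mathcomp Require Import ring lra zify.

Set Implicit Arguments.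
Unset Strict Implicit.
Unset Printing Implicit Defensive.

Import Order.TTheory GRing.Theory Num.Theory.
Import numFieldNormedType.Exports.

Local Open Scope classical_set_scope.
Local Open Scope ring_scope.

(** * Orthonormal polynomials on a geometric lattice *)

(** All estimates are made at scale n^2, with errors e n^2 + C (n + 1) where C depends on e only.
    Factors merely exponential in n, such as (1 - q)^n from the gaps between nodes or the number n +
    1 of terms in Lagrange's formula, therefore disappear in the limit. In the constant kappa + L/2,
    the part L/2 comes from the product of the q^j, j < n, and kappa from w(q^n), the first weight
    that the competitor does not annihilate.

    The obstacle for the zeros is that a node q^k sees a zero far below it only at distance about
    q^k. Hence - ln y_j is controlled only after truncation at L n. A truncated zero still costs L
    (n - j), so truncation is rare except at the last indices, and these are few.

    On the equilibrium side, pushing mass outwards is made quantitative: a competitor with mass P on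
    (0,a], a < q, has energy larger by at least (ln q - ln a) P^2. This identifies every minimizer.
    The comparison is made in one variable of the energy at a time, so it is an inequality between
    linear functionals. *)

Lemma poly_eq0_on_lattice (R : realType) (q : R) (q01 : 0 < q < 1) (r : {poly R}) :
  (forall k, r.[q ^+ k] = 0) -> r = 0.
Proof.
move=> rq; apply/eqP/negPn/negP => r0.
suff : (size [seq q ^+ k | k <- iota 0 (size r)] < size r)%N.
  by rewrite size_map size_iota ltnn.
apply: max_poly_roots => //; last first.
  rewrite map_inj_uniq ?iota_uniq// => i j; apply: (@ieexprIn _ q).
  - by case/andP: q01.
  - by case/andP: q01 => _ ?; rewrite lt_eqF.
by apply/allP => _ /mapP[k _ ->]; apply/rootP.
Qed.

Lemma series_nneg_eq0 (R : realType) (u : nat -> R) : (forall k, 0 <= u k) ->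
  series u @ \oo --> (0 : R) -> forall k, u k = 0.
Proof.
move=> u0 ulim k; apply/eqP; rewrite eq_le u0 andbT.
have nd : nondecreasing_seq (series u) by apply: nondecreasing_series => i _ _; exact: u0.
have := nondecreasing_cvgn_le nd (cvgP _ ulim) k.+1.
rewrite (cvg_lim _ ulim)// => /(le_trans _); apply.
by rewrite seriesSr lerDr; apply: sumr_ge0.
Qed.

Section OrthonormalOnLattice.
Context (R : realType) (q : R) (q01 : 0 < q < 1) (W : nat -> R)
  (W_gt0 : forall k, 0 < W k) (p : nat -> {poly R})
  (p_size : forall n, size (p n) = n.+1)
  (p_lead : forall n, 0 < lead_coef (p n))
  (p_orth : forall n m,
     series (fun k => (p n).[q ^+ k] * (p m).[q ^+ k] * W k) @ \oo --> ((n == m)%:R : R)).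

Lemma lead_coef_size n : lead_coef (p n) = (p n)`_n.
Proof. by rewrite lead_coefE p_size. Qed.

(** Induction on a bound m for the size: subtracting the multiple of [p m] that kills the top
    coefficient lowers the bound. Only the last subtraction, m = n, contributes to the limit. *)
Lemma orthonormal_coef n (r : {poly R}) : (size r <= n.+1)%N ->
  series (fun k => (p n).[q ^+ k] * r.[q ^+ k] * W k) @ \oo --> r`_n / lead_coef (p n).
Proof.
move=> rn.
suff H m : (m <= n.+1)%N -> forall r : {poly R}, (size r <= m)%N ->
    series (fun k => (p n).[q ^+ k] * r.[q ^+ k] * W k) @ \oo --> r`_n / lead_coef (p n).
  exact: (H n.+1).
elim: m => [_ r0|m IH mn r1 r1m].
  rewrite leqn0 size_poly_eq0 => /eqP ->; rewrite coef0 mul0r.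
  rewrite (_ : series _ = fun=> 0); first exact: cvg_cst.
  by apply/funext => N; rewrite /series/= big1// => i _; rewrite horner0 mulr0 mul0r.
pose c := r1`_m / lead_coef (p m).
pose r2 := r1 - c *: p m.
have r2m : (size r2 <= m)%N.
  apply/leq_sizeP => j; rewrite leq_eqVlt => /orP[/eqP <-|mj].
    by rewrite coefB coefZ /c -lead_coef_size divfK ?gt_eqF// subrr.
  rewrite coefB coefZ !nth_default ?mulr0 ?subr0// ?p_size//.
  exact: leq_trans r1m mj.
have -> : series (fun k => (p n).[q ^+ k] * r1.[q ^+ k] * W k) =
   series (fun k => (p n).[q ^+ k] * r2.[q ^+ k] * W k) +
   c *: series (fun k => (p n).[q ^+ k] * (p m).[q ^+ k] * W k).
  apply/funext => N; rewrite /series/= fctE/= fctE scaler_sumr -big_split/=.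
  apply: eq_bigr => i _; rewrite /r2 !hornerE.
  rewrite /GRing.scale/=; ring.
have -> : r1`_n / lead_coef (p n) = r2`_n / lead_coef (p n) + c *: (n == m)%:R.
  have -> : r2`_n = 0 by rewrite nth_default// (leq_trans r2m).
  rewrite mul0r add0r; have [->|nm] := eqVneq n m.
    by rewrite /c/= /GRing.scale/= mulr1.
  have {}mn : (m < n)%N by rewrite ltn_neqAle eq_sym nm -ltnS.
  by rewrite scaler0 nth_default ?mul0r// (leq_trans r1m).
by apply: cvgD; [exact: IH (ltnW mn) _ r2m|apply: cvgZr; exact: p_orth].
Qed.

(** Source of all facts about zeros: a nonnegative series with sum 0 has zero terms, so the product
    of [p n] and r vanishes on the whole lattice, hence identically. *)
Lemma orthonormal_sign n (r : {poly R}) : (size r <= n)%N ->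
  (forall k, 0 <= (p n).[q ^+ k] * r.[q ^+ k]) -> r = 0.
Proof.
move=> rn pr0.
have := orthonormal_coef (leqW rn); rewrite nth_default// mul0r => h.
have /= {}h := series_nneg_eq0 (fun k => mulr_ge0 (pr0 k) (ltW (W_gt0 k))) h.
have : p n * r = 0.
  apply: (poly_eq0_on_lattice q01) => k; rewrite hornerM.
  by move/eqP : (h k); rewrite mulf_eq0 (gt_eqF (W_gt0 k)) orbF => /eqP.
move/eqP; rewrite mulf_eq0 => /orP[/eqP p0|/eqP//].
by have := p_size n; rewrite p0 size_poly0.
Qed.

(** One term of a nonnegative series of sum 1. *)
Lemma orthonormal_le n k : (p n).[q ^+ k] ^+ 2 * W k <= 1.
Proof.
have := @p_orth n n; rewrite eqxx; set u := series _ => h.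
have nd : nondecreasing_seq u.
  by apply: nondecreasing_series => i _ _; rewrite -expr2 mulr_ge0 ?sqr_ge0// ltW.
have := nondecreasing_cvgn_le nd (cvgP _ h) k.+1.
rewrite (cvg_lim _ h)// => /(le_trans _); apply.
rewrite /u seriesSr expr2 lerDr; apply: sumr_ge0 => i _.
by rewrite -expr2 mulr_ge0 ?sqr_ge0// ltW.
Qed.

(* Among the monic polynomials of degree n, p n / lead_coef (p n) has least norm. *)
Lemma lead_coef_extremal n (P : {poly R}) (B : R) : P \is monic -> size P = n.+1 ->
  (forall N, series (fun k => P.[q ^+ k] ^+ 2 * W k) N <= B) ->
  (lead_coef (p n))^-1 ^+ 2 <= B.
Proof.
move=> Pm Ps PB; set g := (lead_coef (p n))^-1.
have P1 : P`_n = 1 by move/monicP: Pm; rewrite /lead_coef Ps.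
have h1 : series (fun k => (p n).[q ^+ k] * P.[q ^+ k] * W k) @ \oo --> g.
  by have := @orthonormal_coef n P; rewrite P1 mul1r Ps; apply.
have h2 := @p_orth n n; rewrite eqxx in h2.
(* Termwise P^2 - (2 g p_n P - g^2 p_n^2) = (P - g p_n)^2, and the subtracted series tends to 2 g^2
   - g^2 = g^2. Only the partial sums for P are bounded, so the limit is taken on this side
   alone. *)
have h : (2 * g) *: series (fun k => (p n).[q ^+ k] * P.[q ^+ k] * W k)
    - g ^+ 2 *: series (fun k => (p n).[q ^+ k] * (p n).[q ^+ k] * W k)
    @ \oo --> (2 * g) *: g - (g ^+ 2) *: (1 : R).
  by apply: cvgB; apply: cvgZr.
have -> : g ^+ 2 = (2 * g) *: g - (g ^+ 2) *: (1 : R) by rewrite /GRing.scale/=; ring.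
rewrite -(cvg_lim _ h)//; apply: limr_le; first exact: (cvgP _ h).
apply: nearW => N; apply: le_trans (PB N).
rewrite /series/= !fctE/= !scaler_sumr -sumrB; apply: ler_sum => i _.
rewrite -subr_ge0 /GRing.scale/=.
set b := P.[_]; set a := (p n).[_].
have -> : b ^+ 2 * W i - (2 * g * (a * b * W i) - g ^+ 2 * (a * a * W i)) = (b - g * a) ^+ 2 * W i by ring.
by rewrite mulr_ge0 ?sqr_ge0// ltW.
Qed.

End OrthonormalOnLattice.

(** Comparison of the coefficients of degree n in Lagrange's interpolation formula; P minus its
    interpolant has n + 1 roots and size at most n + 1. *)
Lemma lagrange_lead_coef (F : fieldType) (n : nat) (t : 'I_n.+1 -> F) (P : {poly F}) :
  injective t -> (size P <= n.+1)%N ->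
  P`_n = \sum_k P.[t k] / \prod_(j | j != k) (t k - t j).
Proof.
move=> tinj Pn.
pose B k := \prod_(j | j != k) ('X - (t j)%:P).
have sB k : size (B k) = n.+1.
  rewrite /B -big_filter size_prod_XsubC; congr _.+1.
  rewrite -sum1_size big_filter; transitivity #|predC1 k|.
    by rewrite -sum1_card; apply: eq_bigl.
  by rewrite cardC1 card_ord.
have mB k : (B k)`_n = 1.
  have : B k \is monic by apply: monic_prod => j _; exact: monicXsubC.
  by move/monicP; rewrite /lead_coef sB.
pose S := \sum_k (P.[t k] / \prod_(j | j != k) (t k - t j)) *: B k.
have D0 k : \prod_(j | j != k) (t k - t j) != 0.
  apply/prodf_neq0 => j jk; rewrite subr_eq0; apply: contra jk => /eqP /tinj ->//.
have PS : P - S = 0.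
  apply/eqP/negPn/negP => PS0.
  suff : (size (codom t) < size (P - S)%R)%N.
    rewrite size_codom card_ord ltnNge; apply/negP/negPn.
    rewrite (leq_trans (size_polyD _ _))// geq_max Pn size_polyN.
    apply: (leq_trans (size_sum _ _ _)); apply/bigmax_leqP => k _.
    by rewrite (leq_trans (size_scale_leq _ _))// sB.
  apply: max_poly_roots => //; last by rewrite map_inj_uniq ?enum_uniq.
  apply/allP => _ /codomP[k ->]; apply/rootP.
  rewrite hornerD hornerN horner_sum (bigD1 k)//= [X in _ - (_ + X)]big1 => [|j jk].
    rewrite addr0 hornerZ horner_prod.
    under [X in _ / _ * X]eq_bigr do rewrite hornerXsubC.
    by rewrite divfK ?subrr.
  rewrite hornerZ horner_prod [X in _ * X](bigD1 k) 1?eq_sym//= hornerXsubC subrr.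
  by rewrite mul0r mulr0.
have {1}-> : P = S by apply/eqP; rewrite -subr_eq0 PS.
by rewrite coef_sum; apply: eq_bigr => k _; rewrite coefZ mB mulr1.
Qed.

(** The sum is the exponent of q in the product of the gaps around q^k. The square (n - k)^2 is what
    later forces the node close to q^n. Doubling and moving terms across keep the identity free of
    division. *)
Lemma sum_minn (n k : nat) : (k <= n)%N ->
  ((\sum_(j < n.+1 | j != k :> nat) minn j k).*2 + (n - k) ^ 2 + k = n ^ 2)%N.
Proof.
move=> kn.
(* With n = k + d and the term j = k included, the sum can be computed by induction on d. *)
have H d : ((\sum_(j < (k + d).+1) minn j k).*2 = k * k.+1 + 2 * (k * d))%N.
  elim: d => [|d IH].
    rewrite addn0 muln0 addn0 (eq_bigr (fun j : 'I_k.+1 => j : nat)).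
      by elim: {kn} k => [|k IH]; rewrite ?big_ord1// big_ord_recr doubleD IH /=; lia.
    by move=> j _; apply/minn_idPl; rewrite -ltnS.
  rewrite addnS big_ord_recr/= doubleD IH (minn_idPr _); lia.
have := H (n - k)%N; rewrite subnKC// (bigD1 (Ordinal (kn : k < n.+1)%N))//= minnn.
set S := (\sum_(_ < _ | _) _)%N.
move: S => S; nia.
Qed.

(** Factoring out the larger of the two points leaves 1 - q^i with i > 0. *)
Lemma lattice_gap (R : realType) (q : R) (q01 : 0 < q < 1) (k j : nat) : j != k ->
  (1 - q) * q ^+ minn j k <= `|q ^+ k - q ^+ j|.
Proof.
case/andP: q01 => q0 q1.
wlog jk : j k / (j < k)%N.
  move=> h jk; move: (jk); rewrite neq_ltn => /orP[jk'|jk']; first exact: h.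
  by rewrite minnC distrC; apply: h => //; rewrite eq_sym.
move=> _; rewrite (minn_idPl (ltnW jk)) distrC -(subnKC (ltnW jk)) exprD.
rewrite -{2}[q ^+ j]mulr1 -mulrBr normrM mulrC (ger0_norm (exprn_ge0 _ (ltW q0))).
rewrite ler_pM2l ?exprn_gt0// ger0_norm.
  rewrite lerD2l lerN2; have : (0 < k - j)%N by rewrite subn_gt0.
  by case: (k - j)%N => // d _; rewrite exprS ler_piMr ?(ltW q0)// exprn_ile1 ?ltW.
by rewrite subr_ge0 exprn_ile1 ?ltW.
Qed.

Lemma lattice_prod_gap (R : realType) (q : R) (q01 : 0 < q < 1) (n : nat) (k : 'I_n.+1) :
  (1 - q) ^+ n * q ^+ (\sum_(j < n.+1 | j != k :> nat) minn j k) <=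
  \prod_(j < n.+1 | j != k) `|q ^+ k - q ^+ j|.
Proof.
have -> : (1 - q) ^+ n = \prod_(j < n.+1 | j != k) (1 - q).
  by rewrite prodr_const; congr (_ ^+ _); rewrite cardC1 card_ord.
rewrite -prodrXr -big_split/=; apply: ler_prod => j jk; rewrite lattice_gap//.
case/andP: q01 => q0 q1; rewrite andbT; apply: mulr_ge0.
  by rewrite subr_ge0 ltW.
by rewrite exprn_ge0// ltW.
Qed.

(** * Location and separation of the zeros on the lattice *)

Section LatticeZeros.
Context (R : realType) (q : R) (q01 : 0 < q < 1) (W : nat -> R)
  (W_gt0 : forall k, 0 < W k) (p : nat -> {poly R})
  (p_size : forall n, size (p n) = n.+1)
  (p_lead : forall n, 0 < lead_coef (p n))
  (p_orth : forall n m,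
     series (fun k => (p n).[q ^+ k] * (p m).[q ^+ k] * W k) @ \oo --> ((n == m)%:R : R)).

Let size_factor n (r : {poly R}) a : (0 < n)%N -> size (r * ('X - a%:P)) = n -> size r = n.-1.
Proof.
move=> n0; have [->|r0] := eqVneq r 0; first by rewrite mul0r size_poly0 => n00; rewrite -n00 in n0.
by rewrite size_mul ?polyXsubC_eq0// size_XsubC addn2 /= => <-.
Qed.

Let p_neq0 n : p n != 0.
Proof. by rewrite -size_poly_gt0 p_size. Qed.

(** As in the next two lemmas, linear factors are divided out of [p n] so that its product with the
    quotient is a square times a factor of constant sign on the lattice; [orthonormal_sign] then
    forces the quotient to vanish. *)
Lemma zero_gt0 n a : root (p n) a -> 0 < a.
Proof.
move=> /factor_theorem[r pr]; rewrite ltNge; apply/negP => a0.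
have rn : size r = n by rewrite (@size_factor n.+1 r a)// -pr p_size.
have /(orthonormal_sign q01 W_gt0 p_size p_lead p_orth) : (size r <= n)%N by rewrite rn.
move=> /(_ _) r0; move: (pr); rewrite r0 ?mul0r; first by apply/eqP; exact: p_neq0.
move=> k; rewrite pr hornerM mulrAC -expr2 mulr_ge0 ?sqr_ge0// hornerXsubC subr_ge0.
by rewrite (le_trans a0)// exprn_ge0//; case/andP: q01 => /ltW.
Qed.

Lemma zero_lt1 n a : root (p n) a -> a < 1.
Proof.
move=> /factor_theorem[r pr]; rewrite ltNge; apply/negP => a1.
have rn : size r = n by rewrite (@size_factor n.+1 r a)// -pr p_size.
have /(orthonormal_sign q01 W_gt0 p_size p_lead p_orth) : (size (- r) <= n)%N by rewrite size_polyN rn.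
move=> /(_ _) r0; move: (pr); rewrite -[r]opprK r0 ?oppr0 ?mul0r; first by apply/eqP; exact: p_neq0.
move=> k; rewrite pr hornerM hornerN mulrN mulrAC -expr2 -mulrN mulr_ge0 ?sqr_ge0//.
rewrite hornerXsubC opprB subr_ge0 (le_trans _ a1)// exprn_ile1//; case/andP: q01 => /ltW//.
by move=> _ /ltW.
Qed.

(** If no lattice point lies strictly between a and b, then (t - a)(t - b) is nonnegative on the
    lattice. *)
Lemma zeros_separated n a b : root (p n) a -> root (p n) b -> a < b ->
  exists k, a < q ^+ k < b.
Proof.
move=> /factor_theorem[r pr] pb ab.
have : root r b.
  move: pb; rewrite pr rootM => /orP[//|]; rewrite root_XsubC => /eqP ba.
  by move: ab; rewrite ba ltxx.
move=> /factor_theorem[r' rr'].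
have rn : size r = n by rewrite (@size_factor n.+1 r a)// -pr p_size.
have n0 : (0 < n)%N.
  rewrite lt0n; apply/eqP => n0; move: rn; rewrite n0 => /eqP; rewrite size_poly_eq0 => /eqP r0.
  by have := p_neq0 n; rewrite pr r0 mul0r eqxx.
have rn' : size r' = n.-1 by rewrite (@size_factor n r' b)// -rr' rn.
apply: contrapT => h.
have /(orthonormal_sign q01 W_gt0 p_size p_lead p_orth) : (size r' <= n)%N by rewrite rn' leq_pred.
move=> /(_ _) r0; have := p_neq0 n; rewrite pr rr' r0 ?mul0r ?eqxx// => k.
rewrite pr rr' !hornerM !hornerXsubC.
set t := q ^+ k.
have -> : r'.[t] * (t - b) * (t - a) * r'.[t] = r'.[t] ^+ 2 * ((t - a) * (t - b)) by ring.
rewrite mulr_ge0 ?sqr_ge0//.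
have [ta|at_] := lerP t a.
  by rewrite mulr_le0// subr_le0// (le_trans ta)// ltW.
have [bt|tb] := lerP b t; first by rewrite mulr_ge0// subr_ge0// ltW.
by exfalso; apply: h; exists k; rewrite at_ tb.
Qed.

Context (n : nat) (x : seq R) (x_size : size x = n) (x_sorted : sorted <%R x)
  (x_root : all (root (p n)) x).

(** Decreasing order counted from 0, so that [y j] is to be compared with [q ^+ j]. *)
Local Notation y j := (nth 0 (rev x) j).

Lemma zero_root j : (j < n)%N -> root (p n) (y j).
Proof.
by move=> jn; apply: (allP x_root); rewrite -mem_rev mem_nth// size_rev x_size.
Qed.

(** A lattice point q^k separates [y j.+1] from [y j], and q^k < y j < q^j forces k > j. *)
Lemma zero_lt_lattice j : (j < n)%N -> y j < q ^+ j.
Proof.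
elim: j => [n0|j IH jn].
  by rewrite expr0; apply: (@zero_lt1 n); exact: zero_root.
have : y j.+1 < y j.
  have : sorted (fun a b => b < a) (rev x) by rewrite rev_sorted.
  by move/sortedP => /(_ 0 j); apply; rewrite size_rev x_size.
case/(zeros_separated (zero_root jn) (zero_root (ltnW jn))) => k /andP[yk ky].
apply: (lt_le_trans yk).
have jk : (j < k)%N.
  rewrite ltnNge; apply/negP => kj; have := lt_trans ky (IH (ltnW jn)).
  by rewrite ltNge ler_wiXn2l//; case/andP: q01 => /ltW// _ /ltW.
by rewrite ler_wiXn2l//; case/andP: q01 => /ltW// _ /ltW.
Qed.

Lemma horner_zeros t : (p n).[t] = lead_coef (p n) * \prod_(j < n) (t - y j).
Proof.
have h := @all_roots_prod_XsubC _ (p n) (rev x).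
rewrite [in LHS]h ?size_rev ?x_size//.
- rewrite hornerZ horner_prod; congr (_ * _).
  rewrite (big_nth 0) size_rev x_size big_mkord; apply: eq_bigr => j _.
  by rewrite hornerXsubC.
- by rewrite all_rev.
- rewrite uniq_rootsE rev_uniq; apply: (@sorted_uniq _ <%R) => //.
  + exact: lt_trans.
Qed.

End LatticeZeros.

(** * Leading coefficients and zeros *)

Lemma ln_prod (R : realType) (I : Type) (s : seq I) (P : pred I) (F : I -> R) :
  (forall i, P i -> 0 < F i) -> ln (\prod_(i <- s | P i) F i) = \sum_(i <- s | P i) ln (F i).
Proof.
(* Positivity is carried along with the logarithm, since [lnM] needs it for each partial product. *)
move=> F0; pose K a b := 0 < a /\ ln a = b :> R.
suff [] : K (\prod_(i <- s | P i) F i) (\sum_(i <- s | P i) ln (F i)) by [].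
elim/big_ind2: _ => [|a b c d [a0 <-] [c0 <-]|i Pi]; rewrite /K; first by rewrite ln1.
  by rewrite mulr_gt0// lnM.
by split => //; exact: F0.
Qed.

Section QuadraticAsymptotics.
Context (R : realType) (q : R) (q01 : 0 < q < 1) (v : nat -> R)
  (v_gt0 : forall k, 0 < v k).
Local Notation W := (fun k => q ^+ k * v k).
Context (W_sum : cvgn (series W)) (p : nat -> {poly R})
  (p_size : forall n, size (p n) = n.+1)
  (p_lead : forall n, 0 < lead_coef (p n))
  (p_orth : forall n m,
     series (fun k => (p n).[q ^+ k] * (p m).[q ^+ k] * W k) @ \oo --> ((n == m)%:R : R))
  (kappa : R) (kappa_ge0 : 0 <= kappa)
  (v_asymp : forall e : R, 0 < e -> exists2 C : R, 0 <= C &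
     forall k, `|ln (v k) + 2 * kappa * k%:R ^+ 2| <= e * k%:R ^+ 2 + C).

Local Notation L := (- ln q).

Let q_gt0 : 0 < q. Proof. by case/andP: q01. Qed.
Let q_lt1 : q < 1. Proof. by case/andP: q01. Qed.
Let L_gt0 : 0 < L. Proof. by rewrite oppr_gt0 ln_lt0. Qed.
Let W_gt0 k : 0 < W k. Proof. by rewrite mulr_gt0// exprn_gt0. Qed.

Let lnq k : ln (q ^+ k) = - (k%:R * L).
Proof. by rewrite lnXn// mulrN opprK mulr_natl. Qed.

(** For k >= n the factor v k is at most its bound at k = n when that bound decreases, and the
    remaining q^k form a geometric series. *)
Lemma lattice_tail (e : R) : 0 < e -> exists2 C : R, 0 <= C & forall n N,
  \sum_(0 <= k < N | (n <= k)%N) W k <= expR (C - (2 * kappa - e) * n%:R ^+ 2).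
Proof.
(* If 2 kappa < e the bound to prove grows with n, and the sum S of the whole series serves as C
   because S <= exp S. *)
move=> e0; have [d0|d0] := ltP (2 * kappa - e) 0.
  have nd : nondecreasing_seq (series W).
    by apply: nondecreasing_series => i _ _; rewrite ltW.
  pose S := limn (series W).
  have SN N : series W N <= S by exact: nondecreasing_cvgn_le.
  have S0 : 0 <= S by apply: le_trans (SN 0%N); rewrite /series/= big_geq.
  exists S => // n N; apply: (@le_trans _ _ S).
    apply: le_trans (SN N); rewrite /series/= [leRHS](bigID (fun k => (n <= k)%N))/= lerDl.
    by apply: sumr_ge0 => i _; rewrite ltW.
  have h1 := expR_ge1Dx (S - (2 * kappa - e) * n%:R ^+ 2).
  apply: le_trans h1; have := sqr_ge0 (n%:R : R); nra.
have [C C0 vC] := v_asymp e0.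
(* The geometric sum 1 / (1 - q) is moved into the exponent, again by u <= exp u. *)
exists (C + (1 - q)^-1) => [|n N].
  by rewrite addr_ge0// invr_ge0 subr_ge0 ltW.
pose B := expR (C - (2 * kappa - e) * n%:R ^+ 2).
apply: (@le_trans _ _ (B * \sum_(0 <= k < N) q ^+ k)).
  rewrite mulr_sumr big_mkcond/=; apply: ler_sum => k _.
  case: ifPn => [nk|_]; last by rewrite mulr_ge0 ?expR_ge0// exprn_ge0// ltW.
  rewrite mulrC ler_pM2r ?exprn_gt0// -[leLHS]lnK ?posrE// ler_expR.
  have := vC k; rewrite ler_norml => /andP[_ h].
  have nk2 : n%:R ^+ 2 <= k%:R ^+ 2 :> R.
    by rewrite ler_sqr ?nnegrE// ler_nat.
  by nra.
have -> : expR (C + (1 - q)^-1 - (2 * kappa - e) * n%:R ^+ 2) = B * expR (1 - q)^-1.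
  by rewrite /B -expRD; congr expR; ring.
rewrite ler_pM2l ?expR_gt0//; apply: (@le_trans _ _ (1 - q)^-1); last first.
  by apply: le_trans (expR_ge1Dx _); rewrite lerDr.
have := @geometric_le_lim R N 1 q ler01 q_gt0.
rewrite (ger0_norm (ltW q_gt0)) => /(_ q_lt1); rewrite div1r; apply: le_trans.
by rewrite /series/=; apply: ler_sum => i _; rewrite /geometric/= mul1r.
Qed.

(* The competitor is the monic polynomial vanishing at the n largest lattice points. *)
Lemma ln_lead_coef_ge (e : R) : 0 < e -> exists2 C : R, 0 <= C & forall n,
  (kappa + L / 2) * n%:R ^+ 2 - ln (lead_coef (p n)) <= e * n%:R ^+ 2 + C * n.+1%:R.
Proof.
move=> e0; have [C C0 tC] := lattice_tail e0.
exists (L + C) => [|n]; first by rewrite addr_ge0// ltW.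
pose P := \prod_(j < n) ('X - (q ^+ j)%:P).
(* P vanishes at q^k for k < n; for k >= n each factor satisfies |q^k - q^j| <= q^j, so |P(q^k)| <=
   q^T with 2 T = n^2 - n. *)
pose T := (\sum_(j < n) j)%N.
have T2 : 2 * T%:R + n%:R = n%:R ^+ 2 :> R.
  have : (2 * T + n = n ^ 2)%N.
    rewrite /T; elim: (n) => [|m]; rewrite ?big_ord0// big_ord_recr/=.
    by move: (\sum_(i < m) i)%N => S; nia.
  by move/(congr1 (fun i => i%:R : R)); rewrite natrD natrM natrX.
have Pm : P \is monic by apply: monic_prod => j _; exact: monicXsubC.
have Ps : size P = n.+1.
  by rewrite /P size_prod_XsubC -sum1_size sum1_card card_ord.
have := lead_coef_extremal W_gt0 p_size p_lead p_orth Pm Ps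
  (B := (q ^+ T) ^+ 2 * expR (C - (2 * kappa - e) * n%:R ^+ 2)).
case/(_ _)/Wrap => [N|].
  apply: (@le_trans _ _ ((q ^+ T) ^+ 2 * \sum_(0 <= k < N | (n <= k)%N) W k)); last first.
    by rewrite ler_wpM2l ?sqr_ge0.
  rewrite mulr_sumr [leRHS]big_mkcond/= /series/=; apply: ler_sum => k _.
  case: ifPn => [nk|].
    rewrite ler_pM2r// /P horner_prod -prodrXl /T -prodrXr -prodrXl.
    apply: ler_prod => j _; rewrite sqr_ge0/= hornerXsubC.
    have kj : q ^+ k <= q ^+ j by rewrite ler_wiXn2l ?(ltW q_gt0) ?(ltW q_lt1)// (leq_trans _ nk)// ltnW.
    have := exprn_gt0 k q_gt0; nra.
  rewrite -ltnNge => kn; rewrite /P horner_prod (bigD1 (Ordinal kn))//=.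
  by rewrite hornerXsubC subrr mul0r expr0n/= mul0r.
rewrite -ler_ln ?posrE ?exprn_gt0 ?invr_gt0//; last by rewrite mulr_gt0 ?expR_gt0 ?exprn_gt0.
rewrite lnM ?posrE ?expR_gt0 ?exprn_gt0// expRK !lnXn ?exprn_gt0 ?invr_gt0// lnV ?posrE//.
rewrite -[(- _) *+ 2]mulr_natl -[(_ *+ T) *+ 2]mulr_natl -[ln q *+ T]mulr_natl.
set g := ln (lead_coef _); move=> h.
rewrite -[n.+1%:R]natr1; have := ler0n R n; have := sqr_ge0 (n%:R : R).
have h2 := mulr_ge0 C0 (ler0n R n); have h3 := mulr_ge0 (ltW L_gt0) (ler0n R n).
have h4 := L_gt0.
have h6 := mulr_ge0 (ltW e0) (sqr_ge0 (n%:R : R)).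
have h5 : ln q * (2 * T%:R + n%:R) = ln q * n%:R ^+ 2 by rewrite T2.
lra.
Qed.

(** Pigeonhole: if all n + 1 terms were below the average, their sum would be below the leading
    coefficient. *)
Lemma lagrange_node n : exists k : 'I_n.+1,
  lead_coef (p n) / n.+1%:R <= `|(p n).[q ^+ k]| / \prod_(j < n.+1 | j != k) `|q ^+ k - q ^+ j|.
Proof.
apply: contrapT => /forallNP h.
have tinj : injective (fun i : 'I_n.+1 => q ^+ i).
  by move=> i j /(ieexprIn q_gt0 _) ij; apply/val_inj/ij; rewrite lt_eqF.
have := @lagrange_lead_coef R n _ (p n) tinj; rewrite p_size => /(_ (leqnn _)).
rewrite -(lead_coef_size p_size) => pE.
have : lead_coef (p n) < \sum_(k < n.+1) lead_coef (p n) / n.+1%:R.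
  rewrite {1}pE; apply: (@le_lt_trans _ _ (\sum_(k < n.+1) `|(p n).[q ^+ k]| / \prod_(j < n.+1 | j != k) `|q ^+ k - q ^+ j|)).
    apply: ler_sum => k _; rewrite (le_trans (ler_norm _))// normrM normfV normr_prod//.
  apply: ltr_sum => [|k _]; first by apply/hasP; exists ord0; rewrite ?mem_index_enum.
  by rewrite ltNge; apply/negP/h.
by rewrite sumr_const card_ord -[X in _ < X]mulr_natr divfK// ltxx.
Qed.

Context (x : forall n, n.-tuple R) (x_sorted : forall n, sorted <%R (x n))
  (x_root : forall n, all (root (p n)) (x n)).
Local Notation y n j := (nth 0 (rev (x n)) j).

(* The node is one that carries at least the average share of the leading coefficient in
   Lagrange's formula at 1, q, ..., q^n. *)
Lemma lattice_node (e : R) : 0 < e -> exists2 C : R, 0 <= C & forall n, exists k : 'I_n.+1,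
  [/\ ln (lead_coef (p n)) <= (kappa + L / 2) * n%:R ^+ 2 + e * n%:R ^+ 2
          + C * n.+1%:R - L / 2 * (n%:R - k%:R) ^+ 2,
      forall j : 'I_n, q ^+ k != y n j &
      - \sum_(j < n) ln `|q ^+ k - y n j| <= L / 2 * n%:R ^+ 2 + C * n.+1%:R].
Proof.
move=> e0; have [C C0 vC] := v_asymp e0.
(* b is the cost of each gap factor 1 - q in [lattice_prod_gap]. *)
pose b := - ln (1 - q).
have b0 : 0 <= b by rewrite oppr_ge0 ln_le0// gerBl ltW.
exists (C + b + L + 1) => [|n]; first by rewrite !addr_ge0// ltW.
have [k kP] := lagrange_node n; exists k.
have kn : (k <= n)%N by rewrite -ltnS.
set D := \prod_(_ < _ | _) _ in kP; set A := `|_| in kP.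
have D_ge := lattice_prod_gap q01 k; rewrite -/D in D_ge.
set E := (\sum_(_ < _ | _) _)%N in D_ge.
have E2 : 2 * E%:R + (n%:R - k%:R) ^+ 2 + k%:R = n%:R ^+ 2 :> R.
  have := sum_minn kn => /(congr1 (fun i => i%:R : R)).
  by rewrite !natrD -muln2 natrM !natrX natrB// -/E => <-; ring.
have D0 : 0 < D.
  by apply: lt_le_trans D_ge; rewrite mulr_gt0 ?exprn_gt0// subr_gt0.
have lead0 := p_lead n.
have A0 : 0 < A.
  have : 0 < A / D by apply: lt_le_trans kP; rewrite divr_gt0.
  by rewrite pmulr_lgt0 ?invr_gt0.
have lnk : ln (n.+1%:R : R) <= n%:R.
  by rewrite -[n.+1%:R]natr1 addrC le_ln1Dx// (lt_le_trans _ (ler0n _ _))// ltrN10.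
have H1 : ln (lead_coef (p n)) - ln (n.+1%:R : R) <= ln A - ln D.
  by rewrite -!ln_div ?posrE// ler_ln ?posrE// divr_gt0.
have H2 : - (n%:R * b) - E%:R * L <= ln D.
  move: D_ge; rewrite -ler_ln ?posrE//; last by rewrite mulr_gt0 ?exprn_gt0// subr_gt0.
  rewrite lnM ?posrE ?exprn_gt0 ?subr_gt0// !lnXn ?subr_gt0// -[ln (1 - q) *+ n]mulr_natl -[ln q *+ E]mulr_natl.
  by rewrite /b; nra.
(* Orthonormality bounds the single term p_n(q^k)^2 q^k v_k by 1. *)
have H3 : 2 * ln A + (- (k%:R * L) + ln (v k)) <= 0.
  have := orthonormal_le W_gt0 p_orth n k.
  rewrite -real_normK ?num_real// -/A -ler_ln ?posrE//; last by rewrite !mulr_gt0 ?exprn_gt0.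
  rewrite ln1 lnM ?posrE ?exprn_gt0//.
  by rewrite lnM ?posrE ?exprn_gt0// lnq lnXn// -[ln A *+ 2]mulr_natl.
have H4 : - (2 * kappa * k%:R ^+ 2) - e * k%:R ^+ 2 - C <= ln (v k).
  by have := vC k; rewrite ler_norml => /andP[+ _]; lra.
have kn2 : k%:R ^+ 2 <= n%:R ^+ 2 :> R by rewrite ler_sqr ?nnegrE// ler_nat.
have knR : k%:R <= n%:R :> R by rewrite ler_nat.
have n0 := ler0n R n; have k0 := ler0n R k; have L0 := L_gt0.
have h1 := mulr_ge0 kappa_ge0 (sqr_ge0 (n%:R : R)).
have h2 : kappa * k%:R ^+ 2 <= kappa * n%:R ^+ 2 by rewrite ler_wpM2l.
have h3 : e * k%:R ^+ 2 <= e * n%:R ^+ 2 by rewrite ler_wpM2l// ltW.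
have h3' : 0 <= e * n%:R ^+ 2 by rewrite mulr_ge0 ?sqr_ge0// ltW.
have h4 : L * k%:R <= L * n%:R by rewrite ler_wpM2l// ltW.
have h5 := mulr_ge0 C0 n0; have h6 := mulr_ge0 b0 n0.
have h7 := mulr_ge0 (ltW L0) n0; have h8 := mulr_ge0 (ltW L0) k0.
have h9 : L * (2 * E%:R + (n%:R - k%:R) ^+ 2 + k%:R) = L * n%:R ^+ 2 by rewrite E2.
have h10 := mulr_ge0 (ltW L0) (sqr_ge0 (n%:R - k%:R : R)).
have AE : A = lead_coef (p n) * \prod_(j < n) `|q ^+ k - y n j|.
  rewrite /A (horner_zeros p_size (size_tuple (x n)) (x_sorted n) (x_root n)).
  by rewrite normrM normr_prod gtr0_norm.
have yk (j : 'I_n) : q ^+ k != y n j.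
  apply/eqP => qy; move: A0; rewrite AE (bigD1 j)//= qy subrr normr0 mul0r mulr0.
  by rewrite ltxx.
(* For the first bound, the k L / 2 allowed by H3 cancels against the k in [E2], and kappa k^2 <=
   kappa n^2. For the second, the sum equals ln A minus the logarithm of the leading coefficient,
   which H1 and H2 bound through D alone. *)
split => //.
  by rewrite -[n.+1%:R]natr1; clear - H1 H2 H3 H4 h1 h2 h3 h3' h4 h5 h6 h7 h8 h9 h10 lnk b0 C0 L0 n0; lra.
have lnA : ln A = ln (lead_coef (p n)) + \sum_(j < n) ln `|q ^+ k - y n j|.
  rewrite AE lnM ?posrE//; last first.
    by apply: prodr_gt0 => j _; rewrite normr_gt0 subr_eq0.
  by rewrite ln_prod// => j _; rewrite normr_gt0 subr_eq0.
by rewrite -[n.+1%:R]natr1; clear - lnA H1 H2 H3 H4 h1 h2 h3 h3' h4 h5 h6 h7 h8 h9 h10 lnk b0 C0 L0 n0; lra.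
Qed.

(** Since - ln y_j >= j L, the right-hand side is optimal to order n^2. The two bounds on the
    leading coefficient give (L/2)(n - k)^2 <= 2 d n^2 + O(n) for the node q^k, and each truncated
    term exceeds - ln |q^k - y_j| by at most L (n - k). *)
Lemma sum_ln_zeros (e : R) : 0 < e -> exists2 C : R, 0 <= C & forall n,
  \sum_(j < n) Num.min (L * n%:R) (- ln (y n j)) <= L / 2 * n%:R ^+ 2 + e * n%:R ^+ 2 + C * n.+1%:R.
Proof.
move=> e0; have L0 := L_gt0.
(* Chosen so that (L / e) (2 d) = e / 2 after the inequality [amgm] below. *)
pose d := e ^+ 2 / (4 * L).
have d0 : 0 < d by rewrite divr_gt0 ?exprn_gt0// mulr_gt0.
have [C1 C10 leadC] := ln_lead_coef_ge d0.
have [C2 C20 nodeC] := lattice_node d0.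
pose M := L / e * (C1 + C2) + C2.
exists M => [|n].
  by rewrite addr_ge0// mulr_ge0 ?addr_ge0// divr_ge0 ?ltW.
have [k [lead_le qy sum_le]] := nodeC n; have := leadC n.
set N := n.+1%:R in lead_le sum_le *; set g := ln (lead_coef _) in lead_le *.
move=> lead_ge.
have kn : k%:R <= n%:R :> R by rewrite ler_nat -ltnS.
have hk : L / 2 * (n%:R - k%:R) ^+ 2 <= 2 * d * n%:R ^+ 2 + (C1 + C2) * N by lra.
(* The distance |q^k - y_j| is at most the larger of its two entries: if that is q^k the truncation
   value L n = L k + L (n - k) is used, otherwise - ln y_j itself. *)
have term (j : 'I_n) : Num.min (L * n%:R) (- ln (y n j)) <= - ln `|q ^+ k - y n j| + L * (n%:R - k%:R).
  have y0 : 0 < y n j.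
    apply: (zero_gt0 q01 W_gt0 p_size p_lead p_orth (n := n)).
    exact: zero_root (size_tuple (x n)) (x_root n) _ (ltn_ord j).
  have ln_le (u : R) : 0 < u -> `|q ^+ k - y n j| <= u -> ln `|q ^+ k - y n j| <= ln u.
    by move=> u0 h; rewrite ler_ln ?posrE// normr_gt0 subr_eq0.
  have qk := exprn_gt0 k q_gt0.
  have nk0 : 0 <= L * (n%:R - k%:R) by rewrite mulr_ge0 ?subr_ge0// ltW.
  rewrite ge_min; have [yq|qy'] := leP (y n j) (q ^+ k).
    apply/orP; left; have /(ln_le _ qk) : `|q ^+ k - y n j| <= q ^+ k.
      by rewrite ler_norml; apply/andP; split; lra.
    by rewrite lnq; nra.
  apply/orP; right; have /(ln_le _ y0) : `|q ^+ k - y n j| <= y n j.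
    by rewrite ler_norml; apply/andP; split; lra.
  by move=> h; rewrite -lerBlDl opprK; nra.
apply: (le_trans (ler_sum _ (fun j _ => term j))).
rewrite big_split/= sumrN sumr_const card_ord -[_ *+ n]mulr_natl.
(* Trades the n copies of L (n - k) for the quadratic quantity bounded by [hk]. *)
have amgm : n%:R * (L * (n%:R - k%:R)) <= e / 2 * n%:R ^+ 2 + L / e * (L / 2 * (n%:R - k%:R) ^+ 2).
  rewrite -subr_ge0.
  have -> : e / 2 * n%:R ^+ 2 + L / e * (L / 2 * (n%:R - k%:R) ^+ 2) - n%:R * (L * (n%:R - k%:R))
     = (e * n%:R - L * (n%:R - k%:R)) ^+ 2 / (2 * e) by field; rewrite gt_eqF.
  by rewrite divr_ge0 ?sqr_ge0// mulr_ge0// ltW.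
have en0 : e != 0 by rewrite gt_eqF.
have Ln0 : ln q != 0 by rewrite lt_eqF// -oppr_gt0.
have hk' : L / e * (L / 2 * (n%:R - k%:R) ^+ 2) <= e / 2 * n%:R ^+ 2 + L / e * (C1 + C2) * N.
  apply: (@le_trans _ _ (L / e * (2 * d * n%:R ^+ 2 + (C1 + C2) * N))).
    by rewrite ler_wpM2l// divr_ge0 ?ltW.
  by rewrite le_eqVlt; apply/orP; left; apply/eqP; rewrite /d; field; rewrite ?oppr_eq0 ?Ln0 ?en0.
by rewrite /M; lra.
Qed.

End QuadraticAsymptotics.

(** * Averages of continuous functions and elementary counting *)

Lemma uniformly_continuous_itv (R : realType) (g : R -> R) (a b : R) :
  {within `[a, b], continuous g} -> forall e : R, 0 < e ->
  exists2 d : R, 0 < d & forall s t, a <= s <= b -> a <= t <= b -> `|s - t| < d -> `|g s - g t| < e.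
Proof.
move=> cg e e0.
have /compact_near_coveringP/near_covering_withinP cov := @segment_compact R a b.
have {}cov := cov R (0 : R)^'+ (fun d s => forall t, a <= t <= b -> `|s - t| < d -> `|g s - g t| < e) _.
have : \forall d \near (0 : R)^'+, `[a, b] `<=` (fun s => forall t, a <= t <= b -> `|s - t| < d -> `|g s - g t| < e).
  apply: cov => x xab.
  have /subspace_continuousP/(_ x xab)/cvgrPdist_lt/(_ (e / 2)) := cg.
  rewrite divr_gt0// => /(_ isT)/nbhs_ballP[r /= r0 hr].
  have r20 : 0 < r / 2 by rewrite divr_gt0.
  near=> s d => /= sab t tab st.
  have xs : `|x - s| < r / 2.
    by near: s; apply/nbhs_ballP; exists (r / 2).
  have dr : d < r / 2 by near: d; exact: nbhs_right_lt.
  have gxs : `|g x - g s| < e / 2.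
    by apply: hr => //=; rewrite /ball/= (lt_trans xs)// ltr_pdivrMr// ltr_pMr// ltr1n.
  have gxt : `|g x - g t| < e / 2.
    apply: hr; last by rewrite /= in_itv.
    rewrite /ball/= -(subrK s x) -addrA (le_lt_trans (ler_normD _ _))//.
    by rewrite [ltRHS]splitr ltrD// (lt_trans st).
  rewrite -(subrK (g x) (g s)) -addrA (le_lt_trans (ler_normD _ _))//.
  by rewrite [ltRHS]splitr ltrD// distrC.
move=> H; near (0 : R)^'+ => d; exists d => // s t sab tab.
have : `[a, b] `<=` (fun s => forall t, a <= t <= b -> `|s - t| < d -> `|g s - g t| < e) by near: d.
by apply => //=; rewrite in_itv.
Unshelve. all: by end_near. Qed.

(** A modulus affine in |s - t| can be averaged, so closeness of points in mean passes to values of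
    g. Beyond the uniform continuity distance d, the oscillation of g is at most itself times |s -
    t| / d. *)
Lemma continuous_affine_modulus (R : realType) (g : R -> R) (a b : R) : a <= b ->
  {within `[a, b], continuous g} -> forall e : R, 0 < e ->
  exists2 M : R, 0 <= M &
    forall s t, a <= s <= b -> a <= t <= b -> `|g s - g t| <= e + M * `|s - t|.
Proof.
move=> ab cg e e0; have [d d0 gd] := uniformly_continuous_itv cg e0.
have [c _ gc] := EVT_max ab cg.
have [c' c'ab gc'] := EVT_min ab cg.
have B0 : 0 <= g c - g c' by rewrite subr_ge0 gc.
exists ((g c - g c') / d) => [|s t sab tab]; first by rewrite divr_ge0// ltW.
have [st|ds] := ltP `|s - t| d.
  by rewrite ltW// (lt_le_trans (gd _ _ sab tab st))// lerDl mulr_ge0// divr_ge0// ltW.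
have h : `|g s - g t| <= g c - g c'.
  have := gc s; have := gc t; have := gc' s; have := gc' t; rewrite !in_itv/= sab tab.
  move=> /(_ isT) ? /(_ isT) ? /(_ isT) ? /(_ isT) ?.
  by rewrite ler_norml; apply/andP; split; lra.
rewrite (le_trans h)//; apply: (@le_trans _ _ ((g c - g c') / d * `|s - t|)); last by rewrite lerDr ltW.
by rewrite mulrAC ler_pdivlMr// ler_wpM2l.
Qed.

Lemma average_continuous (R : realType) (g : R -> R) (a b : nat -> nat -> R) :
  {within `[0, 1], continuous g} ->
  (forall n j, (j < n)%N -> 0 <= a n j <= 1) -> (forall n j, (j < n)%N -> 0 <= b n j <= 1) ->
  (fun n => n%:R^-1 * \sum_(j < n) `|a n j - b n j|) @ \oo --> (0 : R) ->
  (fun n => n%:R^-1 * \sum_(j < n) g (a n j) - n%:R^-1 * \sum_(j < n) g (b n j)) @ \oo --> (0 : R).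
Proof.
move=> cg a01 b01 ab; apply/cvgr0Pnorm_le => e e0.
have e20 : 0 < e / 2 by rewrite divr_gt0.
have [M M0 gM] := continuous_affine_modulus ler01 cg e20.
have M10 : 0 < M + 1 by rewrite ltr_wpDl.
near=> n.
have n0 : (0 : R) < n%:R by rewrite ltr0n; near: n; exact: nbhs_infty_gt.
have ab' : n%:R^-1 * \sum_(j < n) `|a n j - b n j| <= e / 2 / (M + 1).
  apply: le_trans (ler_norm _) _; near: n.
  by move/cvgr0Pnorm_le : ab; apply; rewrite divr_gt0.
rewrite -mulrBr -sumrB normrM ger0_norm ?invr_ge0 ?(ltW n0)//.
apply: (@le_trans _ _ (n%:R^-1 * \sum_(j < n) (e / 2 + M * `|a n j - b n j|))).
  rewrite ler_wpM2l ?invr_ge0 ?(ltW n0)// (le_trans (ler_norm_sum _ _ _))//.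
  by apply: ler_sum => j _; apply: gM; [exact: a01|exact: b01].
rewrite big_split/= sumr_const card_ord -mulr_sumr mulrDr -[(e / 2) *+ n]mulr_natl mulKf ?gt_eqF//.
rewrite mulrCA [leRHS]splitr lerD2l (le_trans (ler_wpM2l M0 ab'))//.
by rewrite mulrCA ler_piMr ?(ltW e20)// ler_pdivrMr// mul1r lerDl.
Unshelve. all: by end_near. Qed.

Lemma eventually_linear_le_quadratic (R : realType) (C e : R) : 0 <= C -> 0 < e ->
  \forall n \near \oo, C * n.+1%:R <= e * n%:R ^+ 2.
Proof.
move=> C0 e0; near=> n.
have n1 : (1 : R) <= n%:R by rewrite ler1n; near: n; exact: nbhs_infty_gt.
have : 2 * C / e <= n%:R by near: n; exact: nbhs_infty_ger.
rewrite ler_pdivrMr// -[n.+1%:R]natr1 => h.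
have := ler_wpM2l (le_trans ler01 n1) h.
have := ler_wpM2l C0 n1; nra.
Unshelve. all: by end_near. Qed.

Lemma sum_tail_indicator (n m : nat) : (\sum_(j < n) (n - j <= m) <= m)%N.
Proof.
(* The bound by m alone does not pass through the induction: removing index 0 adds the indicator of
   n + 1 <= m. *)
suff : (\sum_(j < n) (n - j <= m) <= minn n m)%N by rewrite leq_min => /andP[].
elim: n => [|n IH]; first by rewrite big_ord0.
rewrite big_ord_recl subn0.
have -> : (\sum_(i < n) (n.+1 - lift ord0 i <= m) = \sum_(j < n) (n - j <= m))%N.
  by apply: eq_bigr => i _; rewrite lift0 subSS.
by move: (\sum_(j < n) _)%N IH => S; case: (ltnP n m) => /= nm; lia.
Qed.

(** * Limits of the leading coefficients and of the averages over zeros *)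

Section QuadraticLimits.
Context (R : realType) (q : R) (q01 : 0 < q < 1) (v : nat -> R)
  (v_gt0 : forall k, 0 < v k).
Local Notation W := (fun k => q ^+ k * v k).
Context (W_sum : cvgn (series W)) (p : nat -> {poly R})
  (p_size : forall n, size (p n) = n.+1)
  (p_lead : forall n, 0 < lead_coef (p n))
  (p_orth : forall n m,
     series (fun k => (p n).[q ^+ k] * (p m).[q ^+ k] * W k) @ \oo --> ((n == m)%:R : R))
  (kappa : R) (kappa_ge0 : 0 <= kappa)
  (v_asymp : forall e : R, 0 < e -> exists2 C : R, 0 <= C &
     forall k, `|ln (v k) + 2 * kappa * k%:R ^+ 2| <= e * k%:R ^+ 2 + C)
  (x : forall n, n.-tuple R) (x_sorted : forall n, sorted <%R (x n))
  (x_root : forall n, all (root (p n)) (x n)).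
Local Notation y n j := (nth 0 (rev (x n)) j).

Local Notation L := (- ln q).

Let q_gt0 : 0 < q. Proof. by case/andP: q01. Qed.
Let q_lt1 : q < 1. Proof. by case/andP: q01. Qed.
Let L_gt0 : 0 < L. Proof. by rewrite oppr_gt0 ln_lt0. Qed.
Let W_gt0 k : 0 < W k. Proof. by rewrite mulr_gt0// exprn_gt0. Qed.

Lemma lead_coef_root_cvg :
  (fun n => lead_coef (p n) `^ (1 / n%:R ^+ 2)) @ \oo --> expR (kappa + L / 2).
Proof.
rewrite [X in X @ _](_ : _ = fun n => expR (ln (lead_coef (p n)) / n%:R ^+ 2)); last first.
  by apply/funext => n; rewrite /powR gt_eqF// mulrC div1r.
apply: continuous_cvg; first exact: continuous_expR.
apply/cvgrPdist_le => e e0.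
have e20 : 0 < e / 2 by rewrite divr_gt0.
have [C1 C10 leadC] := ln_lead_coef_ge q01 v_gt0 W_sum p_size p_lead p_orth kappa_ge0 v_asymp e20.
have [C2 C20 nodeC] := lattice_node q01 v_gt0 p_size p_lead p_orth kappa_ge0 v_asymp x_sorted x_root e20.
near=> n.
have n0 : (0 : R) < n%:R by rewrite ltr0n; near: n; exact: nbhs_infty_gt.
have n20 : (0 : R) < n%:R ^+ 2 by rewrite exprn_gt0.
have h1 : C1 * n.+1%:R <= e / 2 * n%:R ^+ 2 by near: n; exact: eventually_linear_le_quadratic.
have h2 : C2 * n.+1%:R <= e / 2 * n%:R ^+ 2 by near: n; exact: eventually_linear_le_quadratic.
have h3 := leadC n; have [k [h4 _ _]] := nodeC n.
have h5 : 0 <= L / 2 * (n%:R - k%:R) ^+ 2 by rewrite mulr_ge0 ?sqr_ge0// divr_ge0// ltW.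
rewrite -[X in X - _](mulfK (lt0r_neq0 n20)) -mulrBl normrM [X in _ * X]ger0_norm ?invr_ge0 ?(ltW n20)//.
by rewrite ler_pdivrMr// ler_norml; apply/andP; split; lra.
Unshelve. all: by end_near. Qed.

Let y_gt0 n (j : 'I_n) : 0 < y n j.
Proof.
apply: (zero_gt0 q01 W_gt0 p_size p_lead p_orth (n := n)).
exact: zero_root (size_tuple (x n)) (x_root n) _ (ltn_ord j).
Qed.

Let ln_y n (j : 'I_n) : j%:R * L <= - ln (y n j).
Proof.
have := zero_lt_lattice q01 W_gt0 p_size p_lead p_orth (size_tuple (x n)) (x_sorted n) (x_root n) (ltn_ord j).
move=> yq; have : ln (y n j) < ln (q ^+ j) by rewrite ltr_ln ?posrE ?exprn_gt0 ?y_gt0.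
rewrite lnXn// -[_ *+ j]mulr_natl; lra.
Qed.

(** Each y_j^(1/n) lies below q^(j/n), so the absolute values measure a one-sided excess, and
    [sum_ln_zeros] leaves a total excess of order d n^2 over the sum of the j L. *)
Lemma zeros_lattice_l1 :
  (fun n => n%:R^-1 * \sum_(j < n) `|y n j `^ (1 / n%:R) - q `^ (j%:R / n%:R)|) @ \oo --> (0 : R).
Proof.
apply/cvgr0Pnorm_le => e e0.
have L0 := L_gt0.
(* The indices with n - j <= n / M are a proportion of at most 1 / M <= e / 2. *)
pose M := (Num.bound (2 / e)).+1.
have M0 : (0 : R) < M%:R by rewrite ltr0n.
have eM : M%:R^-1 <= e / 2.
  rewrite -[leRHS]invrK lef_pV2 ?posrE// ?invr_gt0 ?divr_gt0// invfM invrK mulrC.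
  by rewrite (le_trans (ltW (archi_boundP _))) ?ler_nat// divr_ge0// ltW.
(* The 1 serves the zeros below the truncation threshold, M / L the truncated ones. *)
pose c := 1 + M%:R / L.
have c0 : 0 < c by rewrite addr_gt0// divr_gt0.
(* Makes 2 c d = e / 4. *)
pose d := e / (8 * c).
have d0 : 0 < d by rewrite divr_gt0// mulr_gt0.
have [C C0 sumC] := sum_ln_zeros q01 v_gt0 W_sum p_size p_lead p_orth kappa_ge0 v_asymp x_sorted x_root d0.
near=> n.
have n0 : (0 : R) < n%:R by rewrite ltr0n; near: n; exact: nbhs_infty_gt.
have h1 : C * n.+1%:R <= d * n%:R ^+ 2 by near: n; exact: eventually_linear_le_quadratic.
have h2 : 2 * c * L / e <= n%:R by near: n; exact: nbhs_infty_ger.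
rewrite ger0_norm; last by rewrite mulr_ge0 ?invr_ge0 ?(ltW n0)// sumr_ge0.
(* The difference is at most both 1 and the logarithmic excess divided by n. If truncation is active
   the excess is L (n - j), which is at least L n / M outside the last indices; on these the
   indicator pays. *)
have term (j : 'I_n) : `|y n j `^ (1 / n%:R) - q `^ (j%:R / n%:R)| <=
    c / n%:R * (Num.min (L * n%:R) (- ln (y n j)) - j%:R * L) + (n - j <= n %/ M)%:R.
  have yj := y_gt0 j; have vj := ln_y j.
  have jn : j%:R <= n%:R :> R by rewrite ler_nat ltnW.
  rewrite /powR !gt_eqF// div1r.
  set A := expR (n%:R^-1 * _); set B := expR _.
  have BA : A = B * expR (- ((- ln (y n j) - j%:R * L) / n%:R)).
    by rewrite /A /B -expRD; congr expR; field; rewrite gt_eqF.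
  have B1 : B <= 1.
    rewrite -expR0 ler_expR -oppr_ge0 -mulrN mulr_ge0 ?(ltW L0)// divr_ge0// ltW//.
  have B0 : 0 < B := expR_gt0 _.
  have A0 : 0 < A := expR_gt0 _.
  set w := (- ln (y n j) - j%:R * L) / n%:R in BA.
  have w0 : 0 <= w by rewrite divr_ge0 ?subr_ge0// ltW.
  have hw : 1 - w <= expR (- w) := expR_ge1Dx _.
  have ABw : B - A <= w by rewrite BA; nra.
  have AB : A <= B by rewrite BA ler_piMr ?(ltW B0)// -expR0 ler_expR oppr_le0.
  rewrite ler0_norm ?subr_le0// opprB.
  have jL : j%:R * L <= L * n%:R by rewrite mulrC ler_wpM2l// ltW.
  have m0 : 0 <= Num.min (L * n%:R) (- ln (y n j)) - j%:R * L.
    by rewrite subr_ge0 le_min jL.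
  case: (leqP (n - j) (n %/ M)) => /= nj.
    have : 0 <= c / n%:R * (Num.min (L * n%:R) (- ln (y n j)) - j%:R * L).
      by rewrite mulr_ge0// divr_ge0 ?ltW.
    by move=> ?; lra.
  rewrite addr0.
  have [vL|Lv] := leP (- ln (y n j)) (L * n%:R).
    have -> : c / n%:R * (- ln (y n j) - j%:R * L) = c * w by rewrite /w; ring.
    by rewrite (le_trans ABw)// ler_peMl// /c lerDl divr_ge0 ?ltW.
  apply: (@le_trans _ _ 1); first lra.
  have nMj : n%:R <= M%:R * (n%:R - j%:R) :> R.
    rewrite -natrB ?(ltnW (ltn_ord j))// -natrM ler_nat mulnC.
    by rewrite ltnW// -ltn_divLR.
  apply: (@le_trans _ _ (M%:R / L / n%:R * (L * n%:R - j%:R * L))); last first.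
    by rewrite ler_wpM2r ?subr_ge0// ler_pM2r ?invr_gt0// /c lerDr.
  have -> : M%:R / L / n%:R * (L * n%:R - j%:R * L) = M%:R * (n%:R - j%:R) / n%:R.
    by field; rewrite ?oppr_eq0 (gt_eqF n0) lt_eqF// -oppr_gt0.
  by rewrite ler_pdivlMr// mul1r.
rewrite mulrC ler_pdivrMr//.
apply: (le_trans (ler_sum _ (fun j _ => term j))).
rewrite big_split/= -mulr_sumr sumrB -mulr_suml.
have sumj : \sum_(j < n) j%:R = n%:R * (n%:R - 1) / 2 :> R.
  elim: (n) => [|m IH]; first by rewrite big_ord0 mul0r mul0r.
  by rewrite big_ord_recr/= IH -[m.+1%:R]natr1; field.
have tail : \sum_(j < n) (n - j <= n %/ M)%:R <= n%:R * M%:R^-1 :> R.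
  rewrite -natr_sum ler_pdivlMr// -natrM ler_nat (leq_trans _ (leq_divM n M))//.
  by rewrite leq_mul2r sum_tail_indicator orbT.
have hsum := sumC n.
rewrite sumj; set S := \sum_(_ < _) _ in hsum *.
have h3 : c / n%:R * (S - n%:R * (n%:R - 1) / 2 * L) <= c / n%:R * (2 * d * n%:R ^+ 2 + n%:R * L / 2).
  by rewrite ler_wpM2l ?divr_ge0 ?(ltW c0) ?(ltW n0)//; lra.
have h4 : c / n%:R * (2 * d * n%:R ^+ 2 + n%:R * L / 2) = e / 4 * n%:R + c * L / 2.
  by rewrite /d; field; rewrite !gt_eqF.
have h5 : c * L / 2 <= e / 4 * n%:R.
  by move: h2; rewrite ler_pdivrMr//; lra.
have h6 : n%:R * M%:R^-1 <= e / 2 * n%:R by rewrite mulrC ler_pM2r.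
lra.
Unshelve. all: by end_near. Qed.

Let powR_itv01 (z r : R) : 0 <= z <= 1 -> 0 <= r -> 0 <= z `^ r <= 1.
Proof.
move=> /andP[z0 z1] r0; rewrite powR_ge0/=.
have : z `^ r <= 1 `^ r by rewrite ge0_ler_powR ?nnegrE.
by rewrite powR1.
Qed.

Lemma zeros_average (g : R -> R) : {within `[0, 1], continuous g} ->
  (fun n => n%:R^-1 * \sum_(j < n) g (tnth (x n) j `^ (1 / n%:R))
          - n%:R^-1 * \sum_(j < n) g (q `^ (j%:R / n%:R))) @ \oo --> (0 : R).
Proof.
move=> cg.
(* The roots in x are increasing, whereas the comparison with q^(j/n) needs them decreasing. *)
have -> : (fun n => n%:R^-1 * \sum_(j < n) g (tnth (x n) j `^ (1 / n%:R))
          - n%:R^-1 * \sum_(j < n) g (q `^ (j%:R / n%:R))) =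
   (fun n => n%:R^-1 * \sum_(j < n) g (y n j `^ (1 / n%:R))
          - n%:R^-1 * \sum_(j < n) g (q `^ (j%:R / n%:R))).
  apply/funext => n; congr (_ * _ - _).
  rewrite (reindex_inj rev_ord_inj)/=; apply: eq_bigr => j _.
  by rewrite (tnth_nth 0)/= nth_rev size_tuple.
apply: (average_continuous cg (a := fun n j => y n j `^ (1 / n%:R)) (b := fun n j => q `^ (j%:R / n%:R))).
- move=> n j jn; apply: powR_itv01; last by rewrite divr_ge0.
  rewrite ltW ?(y_gt0 (Ordinal jn))//= ltW//.
  apply: (zero_lt1 q01 W_gt0 p_size p_lead p_orth (n := n)).
  exact: zero_root (size_tuple (x n)) (x_root n) _ jn.
- by move=> n j jn; apply: powR_itv01; rewrite ?divr_ge0 ?(ltW q_gt0) ?(ltW q_lt1).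
- exact: zeros_lattice_l1.
Qed.

End QuadraticLimits.

(** * Circular symmetric measures *)

(** Serves for the shift by [pi] and for the doubling of the angle. *)
Lemma Rintegral_affine (R : realType) (G : R -> R) (c d a b : R) : 0 < c -> a <= b ->
  continuous G ->
  \int[lebesgue_measure]_(t in `[c * a + d, c * b + d]) G t =
  c * \int[lebesgue_measure]_(t in `[a, b]) G (c * t + d).
Proof.
move=> c0 ab cG; pose F : R -> R := fun t => c * t + d.
have cF : continuous F.
  by move=> t; apply: cvgD; [apply: cvgM; [exact: cvg_cst|exact: cvg_id]|exact: cvg_cst].
have dF (t : R) : is_derive t (1 : R) (F : R -> R^o) c.
  have -> : F = c *: id + cst d by apply/funext => s; rewrite /F !fctE.
  by apply: is_derive_eq; rewrite addr0 /GRing.scale/= mulr1.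
have dFE : derive1 F = cst c by apply/funext => t; rewrite derive1E derive_val.
have cGF : continuous (G \o F) by move=> t; apply: continuous_comp; [exact: cF|exact: cG].
have := @integration_by_substitution_increasing R F G a b ab.
rewrite /Rintegral => -> //.
- transitivity (fine (\int[lebesgue_measure]_(t in `[a, b]) (c%:E * (G (c * t + d))%:E))%E).
    by congr fine; apply: eq_integral => t _; rewrite dFE -EFinM mulrC.
  rewrite integralZl//; last first.
    apply: continuous_compact_integrable; first exact: segment_compact.
    exact: continuous_subspaceT.
  rewrite fineM//; apply: integrable_fin_num => //.
  apply: continuous_compact_integrable; first exact: segment_compact.
  exact: continuous_subspaceT.
- by move=> s t _ _ st; rewrite /F ltrD2r ltr_pM2l.
- by rewrite dFE => t _; exact: cvg_cst.
- by rewrite dFE; exact: is_cvg_cst.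
- by rewrite dFE; exact: is_cvg_cst.
- by split => [t _||]; [exact: ex_derive|apply: cvg_at_right_filter; exact: cF|apply: cvg_at_left_filter; exact: cF].
- exact: continuous_subspaceT.
Qed.

(** * Mean of the logarithm over a circle *)

Section CircleMean.
Context {R : realType}.
Implicit Types a b t : R.

(* |1 - z e^(it)|^2 for z = a + ib *)
Definition sqdist1 a b t : R := 1 - 2 * (a * cos t - b * sin t) + (a ^+ 2 + b ^+ 2).

Lemma sqdist1E a b t : sqdist1 a b t =
  (1 - (a * cos t - b * sin t)) ^+ 2 + (a * sin t + b * cos t) ^+ 2.
Proof.
have := cos2Dsin2 t; rewrite /sqdist1 => h.
have -> : a ^+ 2 + b ^+ 2 = (a ^+ 2 + b ^+ 2) * (cos t ^+ 2 + sin t ^+ 2) by rewrite h mulr1.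
ring.
Qed.

Lemma sqdist1_bounds a b t rho : 0 <= rho <= 1 -> a ^+ 2 + b ^+ 2 <= rho ^+ 2 ->
  (1 - rho) ^+ 2 <= sqdist1 a b t <= 4.
Proof.
move=> /andP[r0 r1] abr.
(* X + i Y = z e^(it), so that |X| <= |z| <= rho. *)
set X := a * cos t - b * sin t; set Y := a * sin t + b * cos t.
have XY : a ^+ 2 + b ^+ 2 = X ^+ 2 + Y ^+ 2.
  by rewrite -[LHS]mulr1 -(cos2Dsin2 t) /X /Y; ring.
have : `|X| <= rho.
  rewrite -ler_sqr ?nnegrE// real_normK ?num_real//; have := sqr_ge0 Y; lra.
rewrite sqdist1E -/X -/Y ler_norml => /andP[X1 X2]; have := sqr_ge0 Y.
by move=> Y0; apply/andP; split; nra.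
Qed.

Lemma sqdist1_gt0 a b t : a ^+ 2 + b ^+ 2 < 1 -> 0 < sqdist1 a b t.
Proof.
move=> ab1; rewrite lt_neqAle sqdist1E addr_ge0 ?sqr_ge0// andbT eq_sym.
rewrite paddr_eq0 ?sqr_ge0// !sqrf_eq0; apply/negP => /andP[/eqP h1 /eqP h2].
move: ab1; have -> : a ^+ 2 + b ^+ 2 = (a ^+ 2 + b ^+ 2) * (cos t ^+ 2 + sin t ^+ 2).
  by rewrite cos2Dsin2 mulr1.
have -> : (a ^+ 2 + b ^+ 2) * (cos t ^+ 2 + sin t ^+ 2) =
  (a * cos t - b * sin t) ^+ 2 + (a * sin t + b * cos t) ^+ 2 by ring.
rewrite h2; have -> : a * cos t - b * sin t = 1 by lra.
by rewrite expr0n/= addr0 expr1n ltxx.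
Qed.

(* |1 - z e^(it)| |1 + z e^(it)| = |1 - z^2 e^(2it)| *)
Lemma sqdist1_double a b t :
  sqdist1 a b t * sqdist1 a b (1 * t + pi) = sqdist1 (a ^+ 2 - b ^+ 2) (2 * (a * b)) (2 * t + 0).
Proof.
rewrite /sqdist1 mul1r addr0 cosDpi sinDpi.
have -> : 2 * t = t + t by ring.
rewrite cosD sinD.
have := cos2Dsin2 t; set c := cos t; set s := sin t => cs.
have s2 : s ^+ 2 = 1 - c ^+ 2 by lra.
have -> : c * c - s * s = 2 * c ^+ 2 - 1 by rewrite -!expr2 s2; ring.
apply/eqP; rewrite -subr_eq0; apply/eqP.
transitivity (4 * b ^+ 2 * (1 - c ^+ 2 - s ^+ 2)); first by ring.
by rewrite s2; ring.
Qed.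

Lemma continuous_sqdist1 a b : continuous (sqdist1 a b).
Proof.
move=> t; apply: cvgD; last exact: cvg_cst.
apply: cvgB; first exact: cvg_cst.
apply: cvgM; first exact: cvg_cst.
by apply: cvgB; apply: cvgM; try exact: cvg_cst; [exact: continuous_cos|exact: continuous_sin].
Qed.

Lemma continuous_ln_sqdist1 a b : a ^+ 2 + b ^+ 2 < 1 -> continuous (fun t => ln (sqdist1 a b t)).
Proof.
move=> ab1 t; apply: (@continuous_comp _ _ _ (sqdist1 a b) (@ln R)).
  exact: continuous_sqdist1.
by apply: continuous_ln; exact: sqdist1_gt0.
Qed.

Let J a b := \int[lebesgue_measure]_(t in `[0, 2 * pi]) ln (sqdist1 a b t).

Let integrable_itv (f : R -> R) (c d : R) : continuous f ->
  lebesgue_measure.-integrable `[c, d] (EFin \o f).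
Proof.
move=> cf; apply: continuous_compact_integrable; first exact: segment_compact.
exact: continuous_subspaceT.
Qed.

(** The half [pi, 2 pi] is shifted back onto [0, pi]; there the two logarithms add up to the one for
    z^2 at angle 2t, and t -> 2t maps [0, pi] onto [0, 2 pi] with factor 1/2. *)
Let J_double a b : a ^+ 2 + b ^+ 2 < 1 -> J a b = J (a ^+ 2 - b ^+ 2) (2 * (a * b)) / 2.
Proof.
move=> ab1.
have ab2 : (a ^+ 2 - b ^+ 2) ^+ 2 + (2 * (a * b)) ^+ 2 < 1.
  have -> : (a ^+ 2 - b ^+ 2) ^+ 2 + (2 * (a * b)) ^+ 2 = (a ^+ 2 + b ^+ 2) ^+ 2 by ring.
  by rewrite exprn_ilt1// addr_ge0 ?sqr_ge0.
have cf := continuous_ln_sqdist1 ab1.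
have pi0 := @pi_gt0 R.
have cfs : continuous (fun t => ln (sqdist1 a b (1 * t + pi))).
  move=> t; apply: (@continuous_comp _ _ _ (fun t => 1 * t + pi) (fun t => ln (sqdist1 a b t))); last exact: cf.
  by apply: cvgD; [apply: cvgM; [exact: cvg_cst|exact: cvg_id]|exact: cvg_cst].
rewrite {1}/J.
have := @Rintegral_itvB R (fun t => ln (sqdist1 a b t)) (BLeft 0) (BRight (2 * pi)) pi (integrable_itv _ _ cf).
rewrite !bnd_simp => /(_ (ltW pi0)) /(_ _)/eqP.
have -> : (pi <= 2 * pi :> R) by lra.
move=> /(_ isT); rewrite subr_eq => /eqP ->.
rewrite Rintegral_itv_obnd_cbnd; last first.
  have sub : `](pi : R), (2 * pi)]%classic `<=` `[0, (2 * pi)]%classic.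
    by move=> t; rewrite /= !in_itv/= => /andP[pt ->]; rewrite (le_trans (ltW pi0) (ltW pt)).
  have mA : measurable (`[(0 : R), (2 * pi)]%classic : set (measurableTypeR R)) by exact: measurable_itv.
  have mB : measurable (`](pi : R), (2 * pi)]%classic : set (measurableTypeR R)) by exact: measurable_itv.
  exact: (integrableS mA mB sub (integrable_itv _ _ cf)).
have := @Rintegral_affine R _ 1 pi 0 pi ltr01 (ltW pi0) cf.
rewrite mulr0 add0r mul1r mul1r -mulr2n -[pi *+ 2]mulr_natl => ->.
rewrite -RintegralD//; [|exact: integrable_itv|exact: integrable_itv].
transitivity (\int[lebesgue_measure]_(t in `[0, pi])
    ln (sqdist1 (a ^+ 2 - b ^+ 2) (2 * (a * b)) (2 * t + 0))).
  by apply: eq_Rintegral => t _; rewrite -sqdist1_double lnM ?posrE ?sqdist1_gt0// addrC.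
rewrite /J; have := @Rintegral_affine R _ 2 0 0 pi (ltr0Sn _ 1) (ltW pi0) (continuous_ln_sqdist1 ab2).
rewrite mulr0 !addr0 => ->.
by rewrite [RHS]mulrAC divff ?mul1r// pnatr_eq0.
Qed.

Let J_bound a b rho : 0 <= rho -> rho < 1 -> a ^+ 2 + b ^+ 2 <= rho ^+ 2 ->
  `|J a b| <= (4 + - ln ((1 - rho) ^+ 2)) * (2 * pi).
Proof.
move=> r0 r1 abr; have ab1 : a ^+ 2 + b ^+ 2 < 1.
  by rewrite (le_lt_trans abr)// exprn_ilt1.
have cf := continuous_ln_sqdist1 ab1.
have pi0 := @pi_gt0 R.
apply: (@le_trans _ _ (\int[lebesgue_measure]_(t in `[0, 2 * pi]) `|ln (sqdist1 a b t)|)).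
  by apply: le_normr_Rintegral => //; exact: integrable_itv.
have -> : (4 + - ln ((1 - rho) ^+ 2)) * (2 * pi) =
    \int[lebesgue_measure]_(t in `[0, 2 * pi]) (4 + - ln ((1 - rho) ^+ 2)) :> R.
  by rewrite Rintegral_cst//= lebesgue_measure_itv/= lte_fin mulr_gt0//= subr0.
apply: le_Rintegral => //.
- by apply: integrable_itv => t; apply: cvg_norm; exact: cf.
- by apply: integrable_itv => t; exact: cvg_cst.
move=> t _ /=.
have p0 := sqdist1_gt0 t ab1.
have r20 : 0 < (1 - rho) ^+ 2 by rewrite exprn_gt0// subr_gt0.
have lnr : ln ((1 - rho) ^+ 2) <= 0.
  by rewrite ln_le0// expr_le1// ?subr_ge0 ?(ltW r1)// gerBl.
have /andP[h1 h2] : (1 - rho) ^+ 2 <= sqdist1 a b t <= 4.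
  by apply: sqdist1_bounds => //; rewrite r0 ltW.
have : ln ((1 - rho) ^+ 2) <= ln (sqdist1 a b t) by rewrite ler_ln ?posrE.
have : ln (sqdist1 a b t) <= sqdist1 a b t - 1.
  have := @le_ln1Dx R (sqdist1 a b t - 1); have -> : 1 + (sqdist1 a b t - 1) = sqdist1 a b t by ring.
  by apply; lra.
by move=> ? ?; rewrite ler_norml; apply/andP; split; lra.
Qed.

(* By [J_double] squaring z doubles the mean, which is bounded on |z| <= rho < 1. *)
Lemma circle_mean_ln_sqdist1 a b : a ^+ 2 + b ^+ 2 < 1 ->
  \int[lebesgue_measure]_(t in `[0, 2 * pi]) ln (sqdist1 a b t) = 0.
Proof.
move=> ab1; rewrite -/(J a b).
have ab0 : 0 <= a ^+ 2 + b ^+ 2 by rewrite addr_ge0 ?sqr_ge0.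
pose rho := Num.sqrt (a ^+ 2 + b ^+ 2).
have r0 : 0 <= rho := sqrtr_ge0 _.
have rE : rho ^+ 2 = a ^+ 2 + b ^+ 2 by rewrite sqr_sqrtr.
have r1 : rho < 1 by rewrite -(@expr_lt1 _ 2)// rE.
pose K := (4 + - ln ((1 - rho) ^+ 2)) * (2 * pi).
(* Since rho <= 1, squaring stays in the disk of radius rho, where [J_bound] holds uniformly; n
   doublings divide it by 2^n. *)
have H n : forall c d, c ^+ 2 + d ^+ 2 <= rho ^+ 2 -> `|J c d| <= K / 2 ^+ n.
  elim: n => [|n IH] c d cd; first by rewrite expr0 divr1; exact: J_bound.
  rewrite J_double; last by rewrite (le_lt_trans cd)// exprn_ilt1.
  rewrite normrM normfV (@ger0_norm _ 2)// [2 ^+ n.+1]exprSr invfM [K * (_ * _)]mulrA ler_pM2r ?invr_gt0//.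
  apply: IH.
  have -> : (c ^+ 2 - d ^+ 2) ^+ 2 + (2 * (c * d)) ^+ 2 = (c ^+ 2 + d ^+ 2) ^+ 2 by ring.
  have cd0 : 0 <= c ^+ 2 + d ^+ 2 by rewrite addr_ge0 ?sqr_ge0.
  by rewrite expr2 (le_trans (ler_pM cd0 cd0 cd cd))// ler_piMr ?sqr_ge0// exprn_ile1// ltW.
apply/eqP/negPn/negP => J0.
have {}J0 : 0 < `|J a b| by rewrite normr_gt0.
have K0 : 0 <= K.
  by have := H 0%N a b; rewrite rE lexx expr0 divr1 => /(_ isT); apply: le_trans; exact: ltW.
pose N := Num.bound (K / `|J a b|).
have := H N a b; rewrite rE lexx => /(_ isT); apply/negP; rewrite -ltNge.
rewrite ltr_pdivrMr ?exprn_gt0// mulrC -ltr_pdivrMr//.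
apply: (lt_le_trans (archi_boundP _)); first by rewrite divr_ge0.
by rewrite -/N -natrX ler_nat ltnW// ltn_expl.
Qed.

End CircleMean.

Section AngleMean.
Context {R : realType}.
Implicit Types (y : R * R) (r t : R).

Lemma cabs_ge0 y : 0 <= cabs y.
Proof. exact: sqrtr_ge0. Qed.

Lemma cabs_sqr y : cabs y ^+ 2 = y.1 ^+ 2 + y.2 ^+ 2.
Proof. by rewrite sqr_sqrtr// addr_ge0 ?sqr_ge0. Qed.

(** Factoring the larger of |y| and r out of |y - r e^(it)| leaves |1 - z e^(it)| with |z| < 1. *)
Lemma cabs_sub_polar y r : 0 <= r -> r != cabs y -> exists a b,
  a ^+ 2 + b ^+ 2 < 1 /\ forall t, 0 < cabs (y - polar (r, t)) /\
  ln (cabs (y - polar (r, t))) = ln (Num.max (cabs y) r) + ln (sqdist1 a b t) / 2.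
Proof.
move=> r0 rs; set s := cabs y in rs *.
have s0 : 0 <= s := cabs_ge0 y.
have sE : s ^+ 2 = y.1 ^+ 2 + y.2 ^+ 2 := cabs_sqr y.
pose m := Num.max s r.
suff [a [b [ab1 abE]]] : exists a b, a ^+ 2 + b ^+ 2 < 1 /\ forall t,
    cabs (y - polar (r, t)) ^+ 2 = m ^+ 2 * sqdist1 a b t.
  have m0 : 0 < m.
    rewrite /m lt_max; move: rs; rewrite neq_lt => /orP[rs|sr].
      by rewrite (le_lt_trans r0 rs).
    by rewrite (le_lt_trans s0 sr) orbT.
  exists a, b; split => // t; have p0 := sqdist1_gt0 t ab1.
  have d0 : 0 < cabs (y - polar (r, t)).
    rewrite lt_neqAle cabs_ge0 andbT eq_sym -sqrf_eq0 abE.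
    by rewrite mulf_neq0 ?sqrf_eq0 ?gt_eqF.
  split => //; have := congr1 (@ln R) (abE t).
  rewrite [ln (m ^+ 2 * _)]lnM ?posrE ?exprn_gt0// !lnXn// -[ln (cabs _) *+ 2]mulr_natl -[ln m *+ 2]mulr_natl.
  by rewrite -/m; lra.
have cE t : cabs (y - polar (r, t)) ^+ 2 =
    s ^+ 2 - 2 * r * (y.1 * cos t + y.2 * sin t) + r ^+ 2.
  rewrite cabs_sqr sE.
  have -> : (y - polar (r, t)).1 = y.1 - r * cos t by [].
  have -> : (y - polar (r, t)).2 = y.2 - r * sin t by [].
  have -> : r ^+ 2 = r ^+ 2 * (cos t ^+ 2 + sin t ^+ 2) by rewrite cos2Dsin2 mulr1.
  ring.
rewrite /m; have [sr|rs'|/eqP] := ltgtP s r; last by rewrite eq_sym (negbTE rs).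
  have r0' : r != 0 by rewrite gt_eqF// (le_lt_trans s0).
  (* z is the conjugate of y divided by r. *)
  exists (y.1 / r), (- (y.2 / r)); split => [|t].
    have -> : (y.1 / r) ^+ 2 + (- (y.2 / r)) ^+ 2 = (s / r) ^+ 2.
      transitivity ((y.1 ^+ 2 + y.2 ^+ 2) / r ^+ 2); first by field.
      by rewrite -sE; field.
    by rewrite exprn_ilt1 ?divr_ge0// ltr_pdivrMr ?mul1r// (le_lt_trans s0).
  by rewrite cE /sqdist1 sE; field.
have s0' : 0 < s by rewrite (le_lt_trans r0).
have s0'' : s != 0 by rewrite gt_eqF.
(* z = r / y. *)
exists (r * y.1 / s ^+ 2), (- (r * y.2 / s ^+ 2)).
have -> : (r * y.1 / s ^+ 2) ^+ 2 + (- (r * y.2 / s ^+ 2)) ^+ 2 = (r / s) ^+ 2.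
  transitivity (r ^+ 2 * (y.1 ^+ 2 + y.2 ^+ 2) / (s ^+ 2) ^+ 2); first by field.
  by rewrite -sE; field.
split => [|t].
  by rewrite exprn_ilt1 ?divr_ge0// ltr_pdivrMr ?mul1r.
rewrite cE /sqdist1.
have -> : (r * y.1 / s ^+ 2) ^+ 2 + (- (r * y.2 / s ^+ 2)) ^+ 2 = (r / s) ^+ 2.
  transitivity (r ^+ 2 * (y.1 ^+ 2 + y.2 ^+ 2) / (s ^+ 2) ^+ 2); first by field.
  by rewrite -sE; field.
by field.
Qed.

Local Open Scope ereal_scope.

(* Jensen's formula for a linear polynomial; positive and negative parts are kept
   apart so that the nonnegative Tonelli theorem applies to each of them. *)
Lemma angle_mean_log y r : (0 <= r)%R -> r != cabs y ->
  let f := (fun t => - lne (cabs (y - polar (r, t)))%:E) in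
  [/\ \int[angle_prob]_t f^\- t \is a fin_num &
   \int[angle_prob]_t f^\+ t = (- ln (Num.max (cabs y) r))%:E + \int[angle_prob]_t f^\- t].
Proof.
move=> r0 ry f; have [a [b [ab1 abE]]] := cabs_sub_polar r0 ry.
pose phi t : R := (- (ln (Num.max (cabs y) r) + ln (sqdist1 a b t) / 2))%R.
have fE : f = EFin \o phi.
  by apply/funext => t; have [c0 cE] := abE t; rewrite /f lne_EFin// cE.
have cphi : continuous phi.
  move=> t; apply: cvgN; apply: cvgD; first exact: cvg_cst.
  by apply: cvgM; [exact: continuous_ln_sqdist1|exact: cvg_cst].
have pi0 := @pi_gt0 R.
have cint (g : R -> R) : continuous g -> lebesgue_measure.-integrable `[0%R, (2 * pi)%R] (EFin \o g).
  move=> cg; apply: continuous_compact_integrable; first exact: segment_compact.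
  exact: continuous_subspaceT.
have iphi := cint _ cphi.
have mf : measurable_fun setT f.
  by rewrite fE; apply/measurable_EFinP; exact: continuous_measurable_fun.
have fin (g : R -> \bar R) : lebesgue_measure.-integrable `[0%R, (2 * pi)%R] g ->
    \int[lebesgue_measure]_(t in `[0%R, (2 * pi)%R]) g t \is a fin_num.
  by move=> ig; apply: integrable_fin_num.
have finp : \int[lebesgue_measure]_(t in `[0%R, (2 * pi)%R]) (EFin \o phi)^\+ t \is a fin_num.
  by apply: fin; exact: integrable_funepos.
have finn : \int[lebesgue_measure]_(t in `[0%R, (2 * pi)%R]) (EFin \o phi)^\- t \is a fin_num.
  by apply: fin; exact: integrable_funeneg.
have mean : \int[lebesgue_measure]_(t in `[0%R, (2 * pi)%R]) f t =
    ((2 * pi) * - ln (Num.max (cabs y) r))%:E.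
  rewrite -[LHS]fineK; last by rewrite fE; exact: fin.
  congr EFin; rewrite fE -/(Rintegral _ _ _) /phi.
  transitivity (\int[lebesgue_measure]_(t in `[0, 2 * pi])
      ((- ln (Num.max (cabs y) r)) - 2^-1 * ln (sqdist1 a b t)))%R.
    by apply: eq_Rintegral => t _; rewrite opprD mulrC.
  have cl := continuous_ln_sqdist1 ab1.
  rewrite RintegralB//; last 2 first.
  - by apply: cint => t; exact: cvg_cst.
  - by apply: cint => t; apply: cvgM; [exact: cvg_cst|exact: cl].
  rewrite RintegralZl//; last exact: cint.
  rewrite circle_mean_ln_sqdist1// mulr0 subr0 Rintegral_cst//= lebesgue_measure_itv/=.
  by rewrite lte_fin mulr_gt0//= subr0 mulrC.
have ffin : EFin \o phi = f by rewrite fE.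
rewrite ffin in finp finn.
have mfp : measurable_fun setT f^\+ by exact: measurable_funepos.
have mfn : measurable_fun setT f^\- by exact: measurable_funeneg.
rewrite /angle_prob !integral_uniform//.
rewrite subr0 fin_numM//; split => //.
rewrite -(fineK finp) -(fineK finn) -!EFinM -EFinD; congr EFin.
move: mean; rewrite integralE -(fineK finp) -(fineK finn) -EFinB => -[h].
rewrite -[X in (_ = X + _)%R](mulKf (_ : (2 * pi)%R != 0%R :> R)); last by rewrite gt_eqF// mulr_gt0.
by rewrite -mulrDr -h subrK.
Qed.

End AngleMean.

Local Open Scope ereal_scope.

Lemma cabs_polar (R : realType) (r t : R) : cabs (polar (r, t)) = `|r|%R.
Proof.
by rewrite /cabs /polar/= !exprMn -mulrDr cos2Dsin2 mulr1 sqrtr_sqr.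
Qed.

Lemma measurable_cabs (R : realType) : measurable_fun setT (cabs : cplane R -> R).
Proof.
apply: measurableT_comp; first by apply: continuous_measurable_fun; exact: sqrt_continuous.
by apply: measurable_funD; apply: measurable_funX; [exact: measurable_fst|exact: measurable_snd].
Qed.

Lemma measurable_sub_plane (R : realType) :
  measurable_fun setT (fun u : cplane R * cplane R => (u.1 - u.2)%R : cplane R).
Proof.
apply/measurable_fun_pairP; split => /=; apply: measurable_funB.
- by apply: measurableT_comp; [exact: measurable_fst|exact: measurable_fst].
- by apply: measurableT_comp; [exact: measurable_fst|exact: measurable_snd].
- by apply: measurableT_comp; [exact: measurable_snd|exact: measurable_fst].
- by apply: measurableT_comp; [exact: measurable_snd|exact: measurable_snd].
Qed.

(** For c <= 0 the value is +oo, which is the value of the logarithmic kernel on the diagonal. *)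
Lemma measurable_oppe_lne (R : realType) : measurable_fun setT (fun c : measurableTypeR R => - lne c%:E).
Proof.
rewrite (_ : (fun c : measurableTypeR R => - lne c%:E) =
    (fun c : measurableTypeR R => if (c <= 0)%R then +oo else (- ln c)%:E)).
  apply: measurable_fun_ifT => //.
    by apply: measurable_fun_ler.
  by apply/measurable_EFinP; apply: measurableT_comp => //; exact: measurable_ln.
apply/funext => c; case: ifPn => [c0|]; first by rewrite le0_lneNy.
by rewrite -ltNge => c0; rewrite lne_EFin.
Qed.

Lemma angle_prob_setT (R : realType) : (@angle_prob R) setT = 1.
Proof. exact: probability_setT. Qed.

Lemma integral_angle_cst (R : realType) (c : \bar R) : \int[@angle_prob R]_t c = c.
Proof.
apply: etrans (integral_cst _ measurableT _) _; rewrite -[RHS]mule1; congr (_ * _).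
exact: angle_prob_setT.
Qed.

(** * Potential and energy of a circular measure in terms of its radial part *)

Section CircularMeasure.
Context {R : realType} (nu : probability (measurableTypeR R) R).

Let circ_setT : circ nu setT = 1.
Proof.
rewrite /circ /pushforward preimage_setT -setXTT product_measure1E//.
by rewrite -[RHS]mule1; congr (_ * _); [exact: probability_setT|exact: angle_prob_setT].
Qed.

HB.instance Definition _ := Measure_isProbability.Build _ _ _ (circ nu) circ_setT.

Lemma circ_tonelli (f : cplane R -> \bar R) : measurable_fun setT f -> (forall z, 0 <= f z) ->
  \int[circ nu]_z f z = \int[nu]_r \int[angle_prob]_t f (polar (r, t)).
Proof.
move=> mf f0; rewrite ge0_integral_pushforward//; last exact: measurable_polar.
rewrite preimage_setT fubini_tonelli1//=.
by apply: measurableT_comp => //; exact: measurable_polar.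
Qed.

Lemma measurable_angle_integral (f : cplane R -> \bar R) : measurable_fun setT f ->
  (forall z, 0 <= f z) ->
  measurable_fun setT (fun r : measurableTypeR R => \int[angle_prob]_t f (polar (r, t))).
Proof.
move=> mf f0.
apply: (measurable_fun_fubini_tonelli_F (m2 := angle_prob) (fun u => f (polar u))) => //.
by apply: measurableT_comp => //; exact: measurable_polar.
Qed.

Lemma circ_radial (h : R -> \bar R) : measurable_fun setT h -> (forall r, 0 <= h r) ->
  \int[circ nu]_z h (cabs z) = \int[nu]_r h `|r|%R.
Proof.
move=> mh h0; rewrite (circ_tonelli (f := fun z => h (cabs z)))//; last first.
  by apply: measurableT_comp => //; exact: measurable_cabs.
apply: eq_integral => r _.
under eq_integral do rewrite cabs_polar.
exact: integral_angle_cst.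
Qed.

Lemma circ_cabs (B : set (measurableTypeR R)) : measurable B ->
  circ nu (cabs @^-1` B) = nu [set r | B `|r|%R].
Proof.
move=> mB; rewrite /circ /pushforward.
have -> : polar @^-1` (cabs @^-1` B) = [set r : measurableTypeR R | B `|r|%R] `*` setT.
  by apply/seteqP; split => -[r t] /=; rewrite cabs_polar => //; case.
rewrite product_measure1E//.
  by rewrite -[RHS]mule1; congr (_ * _); exact: angle_prob_setT.
by rewrite -[X in measurable X]setTI; apply: normr_measurable.
Qed.

(** Angular mean of the logarithmic kernel between the circles of radii s and r. On the unit disk
    the maximum with 0 changes nothing; it makes the kernel nonnegative everywhere, as the Tonelli
    and monotonicity arguments require. *)
Definition log_kernel (s r : R) : R := (Num.max 0 (- ln (Num.max s r)))%R.

Lemma log_kernel_ge0 s r : (0 <= log_kernel s r)%R.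
Proof. by rewrite /log_kernel le_max lexx. Qed.

Lemma measurable_log_kernel :
  measurable_fun setT (fun u : measurableTypeR R * measurableTypeR R => (log_kernel u.1 u.2)%:E).
Proof.
apply/measurable_EFinP; apply: measurable_maxr => //.
apply: measurableT_comp => //; apply: measurableT_comp; first exact: measurable_ln.
by apply: measurable_maxr; [exact: measurable_fst|exact: measurable_snd].
Qed.

Lemma measurable_log_kernelr s : measurable_fun setT (fun r : measurableTypeR R => (log_kernel s r)%:E).
Proof. exact: (measurableT_comp measurable_log_kernel (pair1_measurable _)). Qed.

Definition radial_potential (s : R) : \bar R := \int[nu]_r (log_kernel s r)%:E.

Lemma radial_potential_ge0 s : 0 <= radial_potential s.
Proof. by apply: integral_ge0 => r _; rewrite lee_fin log_kernel_ge0. Qed.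

Lemma measurable_radial_potential : measurable_fun setT (radial_potential : measurableTypeR R -> \bar R).
Proof.
apply: (measurable_fun_fubini_tonelli_F (m2 := nu) (fun u => (log_kernel u.1 u.2)%:E)) => //.
- exact: measurable_log_kernel.
- by move=> u; rewrite lee_fin log_kernel_ge0.
Qed.

Hypothesis nu01 : nu `[0%R, 1%R]%classic = 1.
Hypothesis nu_atomless : forall s : R, nu [set s] = 0.

Let null01 : nu (~` `[0%R, 1%R]%classic) = 0.
Proof.
rewrite probability_setC ?nu01 ?subee//.
Qed.

Let null01D s : nu (~` (`[0%R, 1%R]%classic `\ s)) = 0.
Proof.
apply/eqP; rewrite eq_le measure_ge0 andbT.
rewrite setCD; apply: (@le_trans _ _ (nu (~` `[0%R, 1%R]%classic) + nu [set s])).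
  apply: measureU2; [exact/measurableC|exact: measurable_set1].
by rewrite null01 nu_atomless adde0.
Qed.

(** The removed point will be the radius s = |y|, which [angle_mean_log] excludes. *)
Lemma ge0_integral_nu01 s (h : measurableTypeR R -> \bar R) : measurable_fun setT h ->
  (forall r, 0 <= h r) -> \int[nu]_r h r = \int[nu]_(r in `[0%R, 1%R]%classic `\ s) h r.
Proof.
move=> mh h0.
have mN : measurable (~` (`[0%R, 1%R]%classic `\ s) : set (measurableTypeR R)).
  by apply: measurableC; apply: measurableD => //; exact: measurable_set1.
rewrite (ge0_negligible_integral (mu := nu) mN measurableT mh (fun r _ => h0 r) (null01D s)).
by rewrite setTD setCK.
Qed.

Let f (y x : cplane R) := - lne (cabs (y - x)%R)%:E.

Let mf : measurable_fun setT (fun u : cplane R * cplane R => f u.1 u.2).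
Proof.
apply: (measurableT_comp (@measurable_oppe_lne R)).
by apply: (measurableT_comp (@measurable_cabs R)); exact: measurable_sub_plane.
Qed.

Let mfr y : measurable_fun setT (f y).
Proof. exact: (measurableT_comp mf (pair1_measurable _)). Qed.

(** Tonelli is applied to the positive and negative parts separately; by [angle_mean_log] their
    angular means differ by the kernel, and the finite negative part cancels. *)
Lemma log_potential_circ (y : R * R) : (cabs y <= 1)%R ->
  log_potential (circ nu) y = radial_potential (cabs y).
Proof.
move=> y1; rewrite /log_potential integralE.
have mp := measurable_funepos (mfr y); have mn := measurable_funeneg (mfr y).
rewrite (circ_tonelli mp)// (circ_tonelli mn)//.
pose Ap r := \int[angle_prob]_t (f y)^\+ (polar (r, t)).
pose An r := \int[angle_prob]_t (f y)^\- (polar (r, t)).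
rewrite -/(Ap _) -/(An _).
have Ap0 r : 0 <= Ap r by apply: integral_ge0.
have An0 r : 0 <= An r by apply: integral_ge0.
have mAp : measurable_fun setT (Ap : measurableTypeR R -> _) by exact: measurable_angle_integral.
have mAn : measurable_fun setT (An : measurableTypeR R -> _) by exact: measurable_angle_integral.
pose E : set (measurableTypeR R) := `[0%R, 1%R]%classic `\ cabs y.
have mE : measurable E by apply: measurableD => //; exact: measurable_set1.
rewrite [X in X - _](ge0_integral_nu01 (cabs y))// [X in _ - X](ge0_integral_nu01 (cabs y))//.
rewrite /radial_potential (ge0_integral_nu01 (cabs y)); last 2 first.
- exact: measurable_log_kernelr.
- by move=> r; rewrite lee_fin log_kernel_ge0.
rewrite -/E.
(* Two points of the unit disk are at distance at most 2, and ln u <= u. *)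
have An2 r : E r -> An r <= 2%:E.
  move=> [/=]; rewrite in_itv/= => /andP[r0 r1] _.
  rewrite /An -[leRHS](integral_angle_cst).
  apply: ge0_le_integral => //.
    by apply: (measurableT_comp mn); apply: (measurableT_comp (@measurable_polar R)); exact: pair1_measurable.
  move=> t _; rewrite funenegE ge_max lee_fin ler0n andbT /f oppeK.
  have c2 : (cabs (y - polar (r, t)) <= 2)%R.
    rewrite -ler_sqr ?nnegrE ?cabs_ge0// cabs_sqr.
    have -> : ((y - polar (r, t)).1 = y.1 - (polar (r, t)).1)%R by [].
    have -> : ((y - polar (r, t)).2 = y.2 - (polar (r, t)).2)%R by [].
    have h1 : ((polar (r, t)).1 ^+ 2 + (polar (r, t)).2 ^+ 2 <= 1)%R.
      by rewrite -cabs_sqr cabs_polar exprn_ile1// ger0_norm.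
    have h2 : (y.1 ^+ 2 + y.2 ^+ 2 <= 1)%R by rewrite -cabs_sqr exprn_ile1// cabs_ge0.
    have := sqr_ge0 (y.1 + (polar (r, t)).1)%R; have := sqr_ge0 (y.2 + (polar (r, t)).2)%R; nra.
  have [c0|c0] := leP (cabs (y - polar (r, t))%R) 0%R; first by rewrite le0_lneNy// leNye.
  by rewrite lne_EFin// lee_fin (le_trans (ltW (ln_sublinear c0))).
have Anfin : \int[nu]_(r in E) An r \is a fin_num.
  rewrite ge0_fin_numE ?integral_ge0//; apply: (@le_lt_trans _ _ (\int[nu]_(r in E) 2%:E)).
    by apply: ge0_le_integral => //; exact: measurable_funTS.
  by rewrite integral_cst// (le_lt_trans (lee_wpmul2l _ (probability_le1 _ mE)))// mule1 ltry.
rewrite [X in X - _](_ : _ = \int[nu]_(r in E) ((log_kernel (cabs y) r)%:E + An r)); last first.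
  apply: eq_integral => r; rewrite inE => -[/=]; rewrite in_itv/= => /andP[r0 r1] /eqP ry.
  have [_] := angle_mean_log r0 ry.
  have -> : \int[angle_prob]_t (fun t : R => - lne (cabs (y - polar (r, t)))%:E)^\+ t = Ap r.
    by apply: eq_integral => t _; rewrite !funeposE.
  have -> : \int[angle_prob]_t (fun t : R => - lne (cabs (y - polar (r, t)))%:E)^\- t = An r.
    by apply: eq_integral => t _; rewrite !funenegE.
  move=> ApE; apply: (etrans ApE).
  congr (_%:E + _); rewrite /log_kernel [RHS]max_r// oppr_ge0 ln_le0//.
  by rewrite ge_max y1.
rewrite ge0_integralD//; first by rewrite addeK.
- by move=> r _; rewrite lee_fin log_kernel_ge0.
- by apply: measurable_funTS; exact: measurable_log_kernelr.
- by apply: measurable_funTS.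
Qed.

Lemma measurable_log_potential_circ :
  measurable_fun setT (log_potential (circ nu) : cplane R -> \bar R).
Proof.
have -> : log_potential (circ nu) =
    fun y => \int[circ nu]_x (f y)^\+ x - \int[circ nu]_x (f y)^\- x.
  by apply/funext => y; rewrite /log_potential integralE.
apply: emeasurable_funB.
- rewrite (_ : (fun y => _) = fubini_F (circ nu) (fun u : cplane R * cplane R => f u.1 u.2)^\+).
    apply: measurable_fun_fubini_tonelli_F; first exact: measurable_funepos.
    by move=> u; exact: funepos_ge0.
  by apply/funext => y; apply: eq_integral => x _; rewrite !funeposE.
- rewrite (_ : (fun y => _) = fubini_F (circ nu) (fun u : cplane R * cplane R => f u.1 u.2)^\-).
    apply: measurable_fun_fubini_tonelli_F; first exact: measurable_funeneg.
    by move=> u; exact: funeneg_ge0.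
  by apply/funext => y; apply: eq_integral => x _; rewrite !funenegE.
Qed.

Let ge0_integral_norm (h : R -> \bar R) : measurable_fun setT h -> (forall r, 0 <= h r) ->
  \int[nu]_r h `|r|%R = \int[nu]_r h r.
Proof.
move=> mh h0; rewrite (ge0_integral_nu01 0%R)//; last first.
  by apply: measurableT_comp => //; exact: normr_measurable.
rewrite [RHS](ge0_integral_nu01 0%R)//; apply: eq_integral => r.
by rewrite inE => -[/=]; rewrite in_itv/= => /andP[r0 _] _; rewrite ger0_norm.
Qed.

Let circ_outside : circ nu (cabs @^-1` `]1%R, +oo[%classic) = 0.
Proof.
rewrite circ_cabs//; apply/eqP; rewrite eq_le measure_ge0 andbT -null01.
rewrite le_measure ?inE//.
- by rewrite -[X in measurable X]setTI; apply: normr_measurable.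
- exact: measurableC.
move=> r /=; rewrite !in_itv/= andbT => r1; apply/negP; apply: contraTN r1 => /andP[r0 r1].
by rewrite -leNgt ger0_norm.
Qed.

(** Potential and radial potential are identified on the closed disk, outside which [circ nu] has no
    mass. *)
Lemma log_energy_circ : log_energy (circ nu) = \int[nu]_s radial_potential s.
Proof.
rewrite -ge0_integral_norm//; [|exact: measurable_radial_potential|exact: radial_potential_ge0].
rewrite -circ_radial//; [|exact: measurable_radial_potential|exact: radial_potential_ge0].
rewrite /log_energy; apply: ae_eq_integral => //.
- exact: measurable_log_potential_circ.
- apply: measurableT_comp; [exact: measurable_radial_potential|exact: measurable_cabs].
exists (cabs @^-1` `]1%R, +oo[%classic); split.
- by rewrite -[X in measurable X]setTI; apply: measurable_cabs.
- exact: circ_outside.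
move=> y /=; apply: contra_notP; rewrite in_itv/= andbT => /negP; rewrite -leNgt => y1 _.
exact: log_potential_circ.
Qed.

(** Q0 is a measurable version of Q that agrees with it on (0,1]. The value at the origin is
    arbitrary, possibly +oo, but nu has no atom there. *)
Lemma integral_circ_field (Q : R -> \bar R) (Q0 : R -> \bar R) :
  measurable_fun setT Q0 -> (forall r, 0 <= Q0 r) ->
  (forall r, (0 < r <= 1)%R -> Q r = Q0 r) ->
  \int[circ nu]_(x in closed_disk) Q (cabs x) = \int[nu]_r Q0 r.
Proof.
move=> mQ0 Q00 QE; rewrite -ge0_integral_norm// -circ_radial//.
have mD : measurable (closed_disk : set (cplane R)).
  rewrite (_ : closed_disk = cabs @^-1` `]-oo, 1%R]%classic); last first.
    by apply/seteqP; split => z /=; rewrite in_itv.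
  by rewrite -[X in measurable X]setTI; apply: measurable_cabs.
have m1 : measurable_fun setT (fun x : cplane R => Q0 (cabs x)).
  by apply: measurableT_comp => //; exact: measurable_cabs.
have mN : measurable (cabs @^-1` `]1%R, +oo[%classic : set (cplane R)).
  by rewrite -[X in measurable X]setTI; apply: measurable_cabs.
rewrite [RHS](ge0_negligible_integral (mu := circ nu) mN measurableT m1 (fun x _ => Q00 (cabs x)) circ_outside).
have <- : (closed_disk : set (cplane R)) = setT `\` (cabs @^-1` `]1%R, +oo[%classic : set (cplane R)).
  apply/seteqP; split => z /=; rewrite /closed_disk/= in_itv/= andbT.
    by move=> z1; split => //; apply/negP; rewrite -leNgt.
  by move=> [_ /negP]; rewrite -leNgt.
transitivity (\int[circ nu]_(x in closed_disk) (if cabs x == 0%R then Q 0%R else Q0 (cabs x))).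
  apply: eq_integral => x; rewrite inE /closed_disk/= => x1; case: ifPn => [/eqP ->//|x0].
  by rewrite QE// x1 lt_neqAle eq_sym x0 cabs_ge0.
apply: ae_eq_integral => //.
- apply: measurable_funTS; apply: measurable_fun_ifT => //.
  by apply: measurable_fun_eqr => //; exact: measurable_cabs.
- exact: measurable_funTS.
exists (cabs @^-1` [set 0%R]); split.
- by rewrite -[X in measurable X]setTI; apply: measurable_cabs.
- apply: etrans (circ_cabs (measurable_set1 _)) _; rewrite (_ : [set r : measurableTypeR R | [set 0%R] `|r|%R] = [set 0%R]) ?nu_atomless//.
  by apply/seteqP; split => r /=; [move/normr0_eq0|move->; rewrite normr0].
by move=> x /=; apply: contra_notP => x0 _; case: eqP.
Qed.

End CircularMeasure.

(** * The constrained equilibrium measure *)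

Section Constraint.
Context {R : realType} (q : R) (q01 : (0 < q < 1)%R).

Local Notation L := (- ln q)%R.
Local Notation sigma := (constraint q01).
Local Notation D := (`[q, 1%R]%classic : set (measurableTypeR R)).

Let q_gt0 : (0 < q)%R. Proof. by case/andP: q01. Qed.
Let q_lt1 : (q < 1)%R. Proof. by case/andP: q01. Qed.
Let L_gt0 : (0 < L)%R. Proof. by rewrite oppr_gt0 ln_lt0. Qed.

Let mD : measurable D. Proof. exact: measurable_itv. Qed.

Lemma constraint_set1 x : sigma [set x] = 0.
Proof.
rewrite /constraint; have [x01|x01] := boolP (x \in `]0%R, 1%R]).
  rewrite (_ : _ `&` _ = [set x]); first by rewrite integral_set1.
  by apply/seteqP; split => [t []//|t ->].
rewrite (_ : _ `&` _ = set0); first by rewrite integral_set0.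
by apply/seteqP; split => // t [/= -> ]; rewrite (negbTE x01).
Qed.

Lemma constraint_itv (a b : R) : (0 < a)%R -> (a <= b)%R -> (b <= 1)%R ->
  sigma `[a, b]%classic = ((ln b - ln a) / L)%:E.
Proof.
move=> a0; rewrite le_eqVlt => /predU1P[<- _|ab b1].
  by rewrite subrr mul0r set_itv1 constraint_set1.
rewrite /constraint setIidl; last first.
  by move=> t /=; rewrite !in_itv/= => /andP[at_ tb]; rewrite (lt_le_trans a0 at_) (le_trans tb b1).
pose c : R := (- 1 / ln q)%R.
pose F : R -> R := fun t => (c * ln t)%R.
have dF (t : R) : (0 < t)%R -> is_derive t (1 : R)%R (F : R -> R^o) (c * t^-1)%R.
  move=> t0; have h := is_derive1_ln t0.
  have -> : F = (c *: (@ln R : R -> R^o))%R by apply/funext => s; rewrite /F !fctE.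
  exact: is_deriveZ.
have cF (t : R) : (0 < t)%R -> {for t, continuous F}.
  by move=> t0; apply: cvgM; [exact: cvg_cst|exact: continuous_ln].
rewrite (@continuous_FTC2 _ _ F a b)//.
- rewrite -EFinB; congr EFin; rewrite /F /c; field.
  by rewrite lt_eqF// -oppr_gt0.
- apply: continuous_in_subspaceT => t; rewrite inE /= in_itv/= => /andP[at_ _].
  apply: cvgM; first exact: cvg_cst.
  by apply: inv_continuous; rewrite gt_eqF// (lt_le_trans a0).
- split.
  + move=> t; rewrite in_itv/= => /andP[at_ _].
    by have [] := dF _ (lt_trans a0 at_).
  + by apply: cvg_at_right_filter; exact: cF.
  + by apply: cvg_at_left_filter; apply: cF; exact: lt_trans ab.
- move=> t; rewrite in_itv/= => /andP[at_ _].
  by have h := dF _ (lt_trans a0 at_); rewrite derive1E derive_val.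
Qed.

(** This is why the cut is at q: sigma([a,1]) = ln a / ln q reaches 1 there. *)
Lemma constraint_top : sigma D = 1.
Proof.
rewrite constraint_itv ?(ltW q_lt1)// ln1 sub0r divff//.
by rewrite gt_eqF.
Qed.

Definition top_constraint : set (measurableTypeR R) -> \bar R := mrestr sigma mD.

HB.instance Definition _ := Measure.on top_constraint.

Let top_setT : top_constraint setT = 1.
Proof. by rewrite /top_constraint /mrestr setTI constraint_top. Qed.

HB.instance Definition _ := Measure_isProbability.Build _ _ _ top_constraint top_setT.

Lemma feasible_top : feasible q01 top_constraint.
Proof.
split.
  rewrite -[LHS]/(sigma (_ `&` D)) setIidr ?constraint_top//.
  by move=> t /=; rewrite !in_itv/= => /andP[qt ->]; rewrite (le_trans (ltW q_gt0)).
move=> A mA; rewrite -[leLHS]/(sigma (A `&` D)) le_measure ?inE//.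
exact: measurableI.
Qed.

Lemma integral_top (h : measurableTypeR R -> \bar R) : measurable_fun setT h -> (forall r, 0 <= h r) ->
  \int[top_constraint]_r h r = \int[sigma]_(r in D) h r.
Proof.
move=> mh h0.
have N0 : top_constraint (~` D) = 0 by rewrite /top_constraint /mrestr setICl measure0.
rewrite (ge0_negligible_integral (mu := top_constraint) (measurableC mD) measurableT mh (fun r _ => h0 r) N0).
rewrite setTD setCK; apply: eq_measure_integral => A mA AD.
by rewrite -[LHS]/(sigma (A `&` D)) setIidl.
Qed.

Lemma integral_top_le (h : measurableTypeR R -> \bar R) (c : R) : measurable_fun setT h ->
  (forall r, 0 <= h r) -> (forall r, (q <= r <= 1)%R -> h r <= c%:E) ->
  \int[top_constraint]_r h r <= c%:E.
Proof.
move=> mh h0 hc; rewrite integral_top//.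
have c0 : (0 <= c)%R by rewrite -lee_fin (le_trans (h0 q))// hc// lexx ltW.
rewrite -[leRHS]mule1 -constraint_top -integral_cst//.
by apply: ge0_le_integral => //; exact: measurable_funTS.
Qed.

Section Feasible.
Context (nu : probability (measurableTypeR R) R) (nu_feasible : feasible q01 nu).

Lemma feasible_set1 x : nu [set x] = 0.
Proof.
apply/eqP; rewrite eq_le measure_ge0 andbT -(constraint_set1 x).
by apply: nu_feasible.2; exact: measurable_set1.
Qed.

Let nu01 : nu `[0%R, 1%R]%classic = 1 := nu_feasible.1.

Lemma feasible_split : nu `]0%R, q[%classic + nu D = 1.
Proof.
rewrite -measureU//=; last first.
  by apply/seteqP; split => // t [] /=; rewrite !in_itv/= => /andP[_ tq] /andP[qt _]; move: (lt_le_trans tq qt); rewrite ltxx.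
have -> : `]0%R, q[%classic `|` D = `]0%R, 1%R]%classic.
  apply/seteqP; split => t /=; rewrite !in_itv/=.
    by move=> [/andP[-> /ltW tq]|/andP[qt ->]]; rewrite ?(le_trans tq (ltW q_lt1))// (lt_le_trans q_gt0).
  by move=> /andP[t0 t1]; have [qt|tq] := leP q t; [right; rewrite t1|left; rewrite t0].
rewrite -nu01 (_ : `[0%R, 1%R]%classic = [set 0%R] `|` `]0%R, 1%R]%classic); last first.
  apply/seteqP; split => t /=; rewrite !in_itv/=.
    by move=> /andP[]; rewrite le_eqVlt => /predU1P[<-|->]; [left|right].
  by move=> [->|/andP[/ltW -> ->]//]; rewrite lexx ler01.
transitivity (nu [set 0%R] + nu `]0%R, 1%R]%classic); first by rewrite feasible_set1 add0e.
symmetry; apply: measureU => //.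
by apply/seteqP; split => // t [/= ->]; rewrite in_itv/= ltxx.
Qed.

(* The total mass of nu - top_constraint vanishes, and this difference is nonpositive on
   [q, 1], where h is at most h q, and nonnegative to the left of q, where h is at least h q. *)
Lemma feasible_dominance (h : measurableTypeR R -> \bar R) (a c d : R) :
  measurable_fun setT h -> (forall r, 0 <= h r) ->
  (forall s t : R, (0 < s)%R -> (s <= t)%R -> (t <= 1)%R -> h t <= h s) ->
  h q = c%:E -> (0 <= d)%R -> (0 < a < q)%R ->
  (forall r : R, (0 < r <= a)%R -> (c + d)%:E <= h r) ->
  \int[top_constraint]_r h r + d%:E * nu `]0%R, a]%classic <= \int[nu]_r h r.
Proof.
move=> mh h0 anti hq d0 /andP[a0 aq] hd; rewrite integral_top//.
have c0 : (0 <= c)%R by rewrite -lee_fin -hq.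
have mDh : measurable_fun D h by exact: measurable_funTS.
pose C : set (measurableTypeR R) := `]0%R, q[%classic.
pose A : set (measurableTypeR R) := `]0%R, a]%classic.
have mC : measurable C by exact: measurable_itv.
have mA : measurable A by exact: measurable_itv.
have hD r : D r -> h r <= c%:E.
  by rewrite /= in_itv/= => /andP[qr r1]; rewrite -hq anti.
(* On [q,1] g is the nonnegative function c - h, so nu <= sigma bounds its integral from above and
   thereby that of h from below. *)
pose g r := maxe (c%:E - h r) 0.
have mg : measurable_fun setT g.
  by apply: measurable_maxe => //; apply: emeasurable_funB.
have g0 r : 0 <= g r by rewrite /g le_max lexx orbT.
have gh r : D r -> g r + h r = c%:E.
  move=> Dr; have hf : h r \is a fin_num by rewrite ge0_fin_numE// (le_lt_trans (hD _ Dr))// ltry.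
  rewrite /g max_l; first by rewrite subeK.
  by rewrite sube_ge0 ?hf ?orbT//; exact: hD.
have sumE (m : {measure set (measurableTypeR R) -> \bar R}) :
    \int[m]_(r in D) g r + \int[m]_(r in D) h r = c%:E * m D.
  rewrite -ge0_integralD//; last exact: measurable_funTS.
  rewrite -integral_cst//; apply: eq_integral => r; rewrite inE => Dr.
  exact: gh.
have sE : \int[sigma]_(r in D) g r + \int[sigma]_(r in D) h r = c%:E.
  by apply: (etrans (sumE _)); rewrite -[RHS]mule1; congr (_ * _); exact: constraint_top.
have nE : \int[nu]_(r in D) g r + \int[nu]_(r in D) h r = c%:E * nu D := sumE nu.
have gle : \int[nu]_(r in D) g r <= \int[sigma]_(r in D) g r.
  by apply: ge0_le_measure_integral => // S mS; apply: nu_feasible.2.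
(* To the left of q, h is at least c, with the surplus d on ]0,a]. *)
have hC : c%:E * nu C + d%:E * nu A <= \int[nu]_(r in C) h r.
  have -> : nu A = nu (A `&` C).
    rewrite setIidl// => t; rewrite /A /C /= !in_itv/= => /andP[-> ta].
    by rewrite (le_lt_trans ta).
  have mI : measurable_fun C (fun r : measurableTypeR R => (\1_A r)%:E : \bar R).
    by apply/measurable_EFinP; apply: measurable_funTS; exact: measurable_indic.
  have mdI : measurable_fun C (fun r : measurableTypeR R => d%:E * (\1_A r)%:E).
    exact: measurable_funeM.
  have dI0 r : 0 <= d%:E * (\1_A r)%:E by rewrite mule_ge0// lee_fin.
  rewrite -(integral_indic nu mC mA) -ge0_integralZl//.
  rewrite -integral_cst// -ge0_integralD//.
  apply: ge0_le_integral => //.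
  - by move=> r _; rewrite adde_ge0// lee_fin.
  - exact: emeasurable_funD.
  - exact: measurable_funTS.
  move=> r; rewrite /C /= in_itv/= => /andP[r0 rq]; rewrite indicE.
  case: (boolP (r \in A)) => [|_]; rewrite ?mule1 ?mule0 ?adde0.
    by rewrite inE /A /= in_itv/= => rA; rewrite -EFinD; exact: hd.
  by rewrite -hq anti// ltW.
have CD : \int[nu]_(r in C) h r + \int[nu]_(r in D) h r <= \int[nu]_r h r.
  rewrite -ge0_integral_setU//; last 2 first.
  - exact: measurable_funTS.
  - rewrite disj_set2E; apply/eqP; apply/seteqP; split => // t [].
    rewrite /C /= !in_itv/= => /andP[_ tq] /andP[qt _].
    by move: (lt_le_trans tq qt); rewrite ltxx.
  by apply: ge0_subset_integral => //; exact: measurableU.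
apply: le_trans CD; apply: (@le_trans _ _ (c%:E * nu C + d%:E * nu A + \int[nu]_(r in D) h r)); last first.
  exact: leeD2r.
have split1 := feasible_split; rewrite -/C in split1.
have fin (m : {measure set (measurableTypeR R) -> \bar R}) (u : measurableTypeR R -> \bar R) :
    (forall r, 0 <= u r) -> \int[m]_(r in D) u r <= c%:E * m D -> m D <= 1 ->
    \int[m]_(r in D) u r \is a fin_num.
  move=> u0 uc m1; rewrite ge0_fin_numE ?integral_ge0//; apply: (le_lt_trans uc).
  by rewrite (le_lt_trans (lee_wpmul2l _ m1))// ?lee_fin// mule1 ltry.
have sD1 : sigma D <= 1 by rewrite constraint_top.
have nD1 : nu D <= 1 by exact: probability_le1.
have f1 : \int[sigma]_(r in D) h r \is a fin_num.
  by apply: fin => //; rewrite -(sumE (constraint q01)) leeDr// integral_ge0.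
have f2 : \int[sigma]_(r in D) g r \is a fin_num.
  by apply: fin => //; rewrite -(sumE (constraint q01)) leeDl// integral_ge0.
have f3 : \int[nu]_(r in D) h r \is a fin_num.
  by apply: fin => //; rewrite -nE leeDr// integral_ge0.
have f4 : \int[nu]_(r in D) g r \is a fin_num.
  by apply: fin => //; rewrite -nE leeDl// integral_ge0.
have f5 : nu C \is a fin_num by rewrite fin_num_measure.
have f6 : nu D \is a fin_num by rewrite fin_num_measure.
have f7 : nu A \is a fin_num by rewrite fin_num_measure.
move: sE nE gle split1; rewrite -/A -(fineK f1) -(fineK f2) -(fineK f3) -(fineK f4)
  -(fineK f5) -(fineK f6) -(fineK f7) -!EFinM -!EFinD !lee_fin.
move: (fine _) (fine _) (fine _) (fine _) (fine _) (fine _) (fine _) => x1 x2 x3 x4 x5 x6 x7.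
move=> [e1] [e2] e3 [e4].
have : (c * (x2 + x3) = c * 1)%R by rewrite e4.
lra.
Qed.

End Feasible.
End Constraint.

Lemma log_kernel_antir (R : realType) (s r r' : R) : (0 < r)%R -> (r <= r')%R ->
  (log_kernel s r' <= log_kernel s r)%R.
Proof.
move=> r0 rr; rewrite /log_kernel ge_max le_max lexx/= le_max; apply/orP; right.
rewrite lerN2 ler_ln ?posrE ?lt_max ?r0 ?(lt_le_trans r0 rr) ?orbT//.
by rewrite ge_max !le_max lexx rr orbT.
Qed.

Lemma log_kernelC (R : realType) (s r : R) : log_kernel s r = log_kernel r s.
Proof. by rewrite /log_kernel maxC [X in (- ln X)%R]maxC maxC. Qed.

Lemma log_kernel_le (R : realType) (s r : R) : (0 < r <= 1)%R -> (log_kernel s r <= - ln r)%R.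
Proof.
move=> /andP[r0 r1]; rewrite /log_kernel ge_max oppr_ge0 ln_le0//= lerN2.
by rewrite ler_ln ?posrE ?lt_max ?r0 ?orbT// le_max lexx orbT.
Qed.

(** For s <= a the kernel is - ln q at radius q but at least - ln a at radius r <= a. *)
Lemma log_kernel_gap (R : realType) (q a r s : R) : (0 < r)%R -> (r <= a)%R -> (a < q)%R -> (q < 1)%R ->
  (log_kernel q s + (ln q - ln a) * \1_(`]0%R, a]%classic : set R) s <= log_kernel r s)%R.
Proof.
move=> r0 ra aq q1; have a0 := lt_le_trans r0 ra; have q0 := lt_trans a0 aq.
rewrite indicE; case: (boolP (s \in _)) => [|_].
  rewrite inE/= in_itv/= => /andP[s0 sa]; rewrite mulr1.
  have -> : (log_kernel q s = - ln q)%R.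
    rewrite /log_kernel (max_l (ltW (le_lt_trans sa aq))) max_r// oppr_ge0 ln_le0// ltW//.
  apply: (@le_trans _ _ (- ln a)%R); first lra.
  rewrite /log_kernel le_max; apply/orP; right; rewrite lerN2 ler_ln ?posrE ?lt_max ?r0//.
  by rewrite ge_max ra sa.
rewrite mulr0 addr0 ![log_kernel _ s]log_kernelC; apply: log_kernel_antir => //.
exact: (le_trans ra (ltW aq)).
Qed.

(** * Comparison of energies and identification of the minimizer *)

Section Energy.
Context {R : realType} (q : R) (q01 : (0 < q < 1)%R) (Q Q0 : R -> \bar R)
  (mQ0 : measurable_fun setT (Q0 : measurableTypeR R -> \bar R))
  (Q0_ge0 : forall r, 0 <= Q0 r)
  (QE : forall r : R, (0 < r <= 1)%R -> Q r = Q0 r)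
  (Q0_anti : forall s t : R, (0 < s)%R -> (s <= t)%R -> (t <= 1)%R -> Q0 t <= Q0 s)
  (kappa : R) (Q0q : Q0 q = kappa%:E).

Local Notation L := (- ln q)%R.
Local Notation sigma := (constraint q01).
Local Notation star := (top_constraint q01).
Local Notation D := (`[q, 1%R]%classic : set (measurableTypeR R)).

Let q_gt0 : (0 < q)%R. Proof. by case/andP: q01. Qed.
Let q_lt1 : (q < 1)%R. Proof. by case/andP: q01. Qed.
Let L_gt0 : (0 < L)%R. Proof. by rewrite oppr_gt0 ln_lt0. Qed.
Let mD : measurable D. Proof. exact: measurable_itv. Qed.

Lemma weighted_energy_circ (nu : probability (measurableTypeR R) R) : feasible q01 nu ->
  weighted_energy Q (circ nu) = \int[nu]_s radial_potential nu s + 2%:E * \int[nu]_r Q0 r.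
Proof.
move=> nuF; have nu01 := nuF.1; have nu1 := feasible_set1 nuF.
rewrite /weighted_energy (log_energy_circ nu01 nu1); congr (_ + _ * _).
exact: integral_circ_field.
Qed.

Lemma radial_potential_anti (nu : probability (measurableTypeR R) R) (s t : R) :
  (0 < s)%R -> (s <= t)%R -> radial_potential nu t <= radial_potential nu s.
Proof.
move=> s0 st; apply: ge0_le_integral => //.
- by move=> r _; rewrite lee_fin log_kernel_ge0.
- exact: measurable_log_kernelr.
- exact: measurable_log_kernelr.
- by move=> r _; rewrite lee_fin ![log_kernel _ r]log_kernelC log_kernel_antir.
Qed.

Lemma radial_potential_le (nu : probability (measurableTypeR R) R) (s : R) : (0 < s <= 1)%R ->
  radial_potential nu s <= (- ln s)%:E.
Proof.
move=> s01; rewrite -[leRHS]mule1 -(probability_setT nu) -integral_cst//.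
apply: ge0_le_integral => //.
- by move=> r _; rewrite lee_fin log_kernel_ge0.
- exact: measurable_log_kernelr.
- by move=> r _; rewrite lee_fin log_kernelC log_kernel_le.
Qed.

(** Finiteness allows this energy to be cancelled in [energy_gap]. On [q,1] the potential is at most
    L and the field at most kappa. *)
Lemma energy_top_lt_pinfty : weighted_energy Q (circ star) < +oo.
Proof.
rewrite (weighted_energy_circ (feasible_top q01)).
have h1 : \int[star]_s radial_potential star s <= L%:E.
  apply: integral_top_le.
  - exact: measurable_radial_potential.
  - exact: radial_potential_ge0.
  move=> r /andP[qr r1]; apply: (le_trans (radial_potential_anti _ q_gt0 qr)).
  by apply: radial_potential_le; rewrite q_gt0 ltW.
have h2 : \int[star]_r Q0 r <= kappa%:E.
  by apply: integral_top_le => // r /andP[qr r1]; rewrite -Q0q Q0_anti.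
apply: (@le_lt_trans _ _ (L%:E + 2%:E * kappa%:E)).
  by apply: leeD => //; apply: lee_wpmul2l.
by rewrite -EFinM -EFinD ltry.
Qed.

(* Dominance is applied to both variables of the energy; the increment comes from the
   potential, which exceeds its value at q by at least (ln q - ln a) nu ]0, a] on ]0, a]. *)
Lemma energy_gap (nu : probability (measurableTypeR R) R) (a : R) : feasible q01 nu ->
  (0 < a < q)%R ->
  weighted_energy Q (circ star)
    + ((ln q - ln a) * fine (nu `]0%R, a]%classic) * fine (nu `]0%R, a]%classic))%:E
  <= weighted_energy Q (circ nu).
Proof.
move=> nuF aq; have /andP[a0 aq'] := aq.
rewrite (weighted_energy_circ nuF) (weighted_energy_circ (feasible_top q01)).
pose A : set (measurableTypeR R) := `]0%R, a]%classic.
have mA : measurable A by exact: measurable_itv.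
rewrite -/A; set P := fine (nu A).
have PE : nu A = P%:E by rewrite fineK// fin_num_measure.
have P0 : (0 <= P)%R by rewrite fine_ge0.
have lnqa : (0 <= ln q - ln a)%R by rewrite subr_ge0 ler_ln ?posrE// ltW.
have mV (m : probability (measurableTypeR R) R) :
    measurable_fun setT (radial_potential m : measurableTypeR R -> \bar R).
  exact: measurable_radial_potential.
(* Dominance in the inner variable, without surplus. *)
have V_le s : radial_potential star s <= radial_potential nu s.
  have := @feasible_dominance R q q01 nu nuF (fun r => (log_kernel s r)%:E) a (log_kernel s q) 0%R.
  rewrite mul0e adde0; apply => //.
  - exact: measurable_log_kernelr.
  - by move=> r; rewrite lee_fin log_kernel_ge0.
  - by move=> r r' r0 rr' _; rewrite lee_fin log_kernel_antir.
  - by move=> r /andP[r0 ra]; rewrite addr0 lee_fin log_kernel_antir// (le_trans ra)// ltW.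
have Vq_fin : radial_potential nu q \is a fin_num.
  rewrite ge0_fin_numE ?radial_potential_ge0//.
  apply: (le_lt_trans (radial_potential_le _ _)); first by rewrite q_gt0 ltW.
  exact: ltry.
have V_gap (r : R) : (0 < r <= a)%R ->
    (fine (radial_potential nu q) + (ln q - ln a) * P)%:E <= radial_potential nu r.
  move=> /andP[r0 ra]; rewrite EFinD fineK// EFinM -PE.
  have mI : measurable_fun setT (fun s : measurableTypeR R => (\1_A s)%:E : \bar R).
    by apply/measurable_EFinP; exact: measurable_indic.
  have -> : nu A = \int[nu]_s (\1_A s)%:E by rewrite integral_indic// setIT.
  rewrite -ge0_integralZl//.
  have mZ : measurable_fun setT (fun s : measurableTypeR R => (ln q - ln a)%:E * (\1_A s)%:E).
    exact: measurable_funeM.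
  have Z0 s : 0 <= (ln q - ln a)%:E * (\1_A s)%:E by rewrite mule_ge0// lee_fin.
  have K0 t (s : measurableTypeR R) : 0 <= (log_kernel t s)%:E by rewrite lee_fin log_kernel_ge0.
  have mK := measurable_log_kernelr.
  rewrite /radial_potential -ge0_integralD//.
  apply: ge0_le_integral => //.
  - by move=> s _; rewrite adde_ge0.
  - exact: emeasurable_funD.
  - by move=> s _; rewrite -EFinM -EFinD lee_fin log_kernel_gap.
(* Dominance in the outer variable: the potential of nu decreases in the radius, and its surplus on
   ]0,a] is proportional to P, which makes the gain quadratic in P. *)
have h1 := @feasible_dominance R q q01 nu nuF (radial_potential nu) a (fine (radial_potential nu q))
  ((ln q - ln a) * P)%R (mV nu) (radial_potential_ge0 nu)
  (fun s t s0 st _ => radial_potential_anti nu s0 st) (esym (fineK Vq_fin)) (mulr_ge0 lnqa P0) aq V_gap.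
have h2 := @feasible_dominance R q q01 nu nuF Q0 a kappa 0%R mQ0 Q0_ge0 Q0_anti Q0q (lexx _) aq.
have {}h2 : \int[star]_r Q0 r <= \int[nu]_r Q0 r.
  move: h2; rewrite mul0e adde0; apply => r /andP[r0 ra].
  by rewrite addr0 -Q0q Q0_anti// ?(le_trans ra)// ltW.
have h3 : \int[star]_s radial_potential star s <= \int[star]_s radial_potential nu s.
  by apply: ge0_le_integral => // s _; exact: radial_potential_ge0.
rewrite -/A PE -EFinM in h1.
rewrite addeAC; apply: leeD; last exact: lee_wpmul2l.
by apply: le_trans h1; exact: leeD2r.
Qed.

(** By the gap a minimizer has no mass on ]0,a] for any a < q, hence none to the left of q. It is
    then dominated by sigma on [q,1], and two probability measures ordered in this way coincide. *)
Lemma constrained_equilibriumE (nu : probability (measurableTypeR R) R) :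
  constrained_equilibrium q01 Q nu ->
  forall A, measurable A -> nu A = sigma (A `&` D).
Proof.
move=> [nuF numin].
have null (a : R) : (0 < a < q)%R -> nu `]0%R, a]%classic = 0.
  move=> aq; have /andP[a0 aq'] := aq.
  have := le_trans (energy_gap nuF aq) (numin _ (feasible_top q01)).
  have sfin : weighted_energy Q (circ star) \is a fin_num.
    rewrite ge0_fin_numE ?energy_top_lt_pinfty//.
    rewrite (weighted_energy_circ (feasible_top q01)) adde_ge0//.
      by apply: integral_ge0 => s _; exact: radial_potential_ge0.
    by rewrite mule_ge0// integral_ge0.
  rewrite -[leRHS]adde0 leeD2lE// lee_fin.
  have lnqa : (0 < ln q - ln a)%R by rewrite subr_gt0 ltr_ln ?posrE.
  have P0 : (0 <= fine (nu `]0%R, a]%classic))%R by rewrite fine_ge0.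
  rewrite -mulrA pmulr_rle0// => PP.
  have PP0 : fine (nu `]0%R, a]%classic) = 0%R.
    by apply/eqP; rewrite -sqrf_eq0 expr2 eq_le PP mulr_ge0.
  by rewrite -(fineK (fin_num_measure nu _ (measurable_itv _))) PP0.
have nuC : nu `]0%R, q[%classic = 0.
  apply/eqP; rewrite eq_le measure_ge0 andbT; apply/lee_addgt0Pr => e e0; rewrite add0e.
  (* Chosen so that sigma([a,q]) = e. *)
  pose a := (q * expR (- (e * L)))%R.
  have a0 : (0 < a)%R by rewrite mulr_gt0// expR_gt0.
  have aq : (a < q)%R.
    by rewrite /a -[ltRHS]mulr1 ltr_pM2l// -expR0 ltr_expR oppr_lt0 mulr_gt0.
  apply: (@le_trans _ _ (nu `]0%R, a]%classic + nu `[a, q]%classic)).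
    apply: (@le_trans _ _ (nu (`]0%R, a]%classic `|` `[a, q]%classic))); last exact: measureU2.
    rewrite le_measure ?inE//; first exact: measurableU.
    move=> t /=; rewrite !in_itv/= => /andP[t0 tq].
    by have [ta|at_] := leP t a; [left; rewrite t0|right; rewrite !ltW].
  rewrite null ?a0// add0e; apply: (le_trans (nuF.2 _ (measurable_itv _))).
  rewrite constraint_itv ?(ltW aq) ?(ltW q_lt1)// lee_fin /a lnM ?posrE ?expR_gt0// expRK.
  by rewrite le_eqVlt; apply/orP; left; apply/eqP; field; rewrite ?oppr_eq0 lt_eqF// -oppr_gt0.
have nuD : nu D = 1 by have := feasible_split nuF; rewrite nuC add0e.
have nuDC : nu (~` D) = 0 by rewrite probability_setC// nuD subee.
have nu_le A : measurable A -> nu A <= sigma (A `&` D).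
  move=> mA; apply: (@le_trans _ _ (nu (A `&` D) + nu (~` D))).
    apply: (@le_trans _ _ (nu ((A `&` D) `|` ~` D))); last first.
      by apply: measureU2; [exact: measurableI|exact: measurableC].
    rewrite le_measure ?inE//.
      by apply: measurableU; [exact: measurableI|exact: measurableC].
    by move=> t At; have [Dt|Dt] := pselect (D t); [left|right].
  by rewrite nuDC adde0; apply: nuF.2; exact: measurableI.
(* The reverse inequality is [nu_le] for the complement of A, both total masses being 1. *)
move=> A mA; apply/eqP; rewrite eq_le nu_le//=.
have tC := probability_setC star mA.
have := nu_le _ (measurableC mA); rewrite probability_setC//.
have -> : sigma (~` A `&` D) = 1 - sigma (A `&` D) by exact: tC.
have f1 : nu A \is a fin_num by rewrite fin_num_measure.
have f2 : sigma (A `&` D) \is a fin_num.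
  exact: (fin_num_measure star A mA).
by rewrite -(fineK f1) -(fineK f2) -!EFinB !lee_fin; lra.
Qed.

End Energy.

Local Close Scope ereal_scope.

(** Supports are tested on open sets, whereas the sigma-algebra of the plane is a product; rational
    boxes connect the two. *)
Lemma open_measurable_plane (R : realType) (B : set (R * R)) : open B -> measurable (B : set (cplane R)).
Proof.
move=> oB.
pose box (a b r : R) : set (cplane R) := `]a - r, a + r[%classic `*` `]b - r, b + r[%classic.
have -> : B = \bigcup_(a : rat) \bigcup_(b : rat) \bigcup_(r : rat)
    (if `[< box (ratr a) (ratr b) (ratr r) `<=` B >] then box (ratr a) (ratr b) (ratr r) else set0).
  apply/seteqP; split => z; last first.
    by move=> [a _ [b _ [r _]]]; case: asboolP => // h; exact: h.
  move=> Bz.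
  have /nbhs_ballP[e /= e0 Be] : nbhs z B by exact: open_nbhs_nbhs.
  have e20 : 0 < e / 2 by rewrite divr_gt0.
  have [r] := rat_in_itvoo e20; rewrite in_itv/= => /andP[r0 re].
  have [a] := @rat_in_itvoo R (z.1 - ratr r) (z.1 + ratr r) ltac:(lra).
  rewrite in_itv/= => /andP[a1 a2].
  have [b] := @rat_in_itvoo R (z.2 - ratr r) (z.2 + ratr r) ltac:(lra).
  rewrite in_itv/= => /andP[b1 b2].
  exists a => //; exists b => //; exists r => //.
  rewrite (_ : `[< _ >] = true); first by rewrite /box/= !in_itv/=; split; apply/andP; split; lra.
  apply/asboolP => y [/=]; rewrite !in_itv/= => /andP[? ?] /andP[? ?].
  apply: Be; split; rewrite /ball/= ltr_norml; apply/andP; split; lra.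
apply: bigcupT_measurable_rat => a; apply: bigcupT_measurable_rat => b.
apply: bigcupT_measurable_rat => r; case: ifPn => // _.
by apply: measurableX; exact: measurable_itv.
Qed.

Lemma angle_prob_itv (R : realType) (e : R) : 0 < e <= 1 ->
  @angle_prob R `[0, e]%classic = (e / (2 * pi))%:E.
Proof.
move=> /andP[e0 e1]; have pi2 := @pi_ge2 R.
transitivity (\int[@angle_prob R]_t (\1_(`[0, e]%classic : set (measurableTypeR R)) t)%:E)%E.
  by rewrite integral_indic// setIT.
rewrite /angle_prob integral_uniform//; last by apply/measurable_EFinP; exact: measurable_indic.
rewrite integral_indic//.
rewrite setIidl; last first.
  move=> t /=; rewrite !in_itv/= => /andP[-> te]/=; lra.
transitivity (((2 * pi)^-1)%:E * e%:E)%E; last by rewrite -EFinM mulrC.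
congr (_ * _)%E; first by rewrite subr0.
by apply: etrans (lebesgue_measure_itv `[0, e]) _; rewrite /= lte_fin e0 -EFinB subr0.
Qed.

(** * The constraint on [q,1]: limit of averages, potential at q, supports *)

Section TopConstraint.
Context {R : realType} (q : R) (q01 : 0 < q < 1).
Local Notation L := (- ln q).
Local Notation sigma := (constraint q01).
Local Notation D := (`[q, 1]%classic : set (measurableTypeR R)).
Context (nu : probability (measurableTypeR R) R) (nuF : feasible q01 nu)
  (nuE : forall A, measurable A -> nu A = sigma (A `&` D)).

Let q_gt0 : 0 < q. Proof. by case/andP: q01. Qed.
Let q_lt1 : q < 1. Proof. by case/andP: q01. Qed.
Let L_gt0 : 0 < L. Proof. by rewrite oppr_gt0 ln_lt0. Qed.
Let mD : measurable D. Proof. exact: measurable_itv. Qed.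

Lemma top_itv (a b : R) : q <= a -> a <= b -> b <= 1 ->
  nu `[a, b]%classic = ((ln b - ln a) / L)%:E.
Proof.
move=> qa ab b1; rewrite nuE//.
rewrite setIidl ?constraint_itv// ?(lt_le_trans q_gt0)//.
by move=> t /=; rewrite !in_itv/= => /andP[at_ tb]; rewrite (le_trans qa at_) (le_trans tb b1).
Qed.

Lemma top_itv_oc (a b : R) : q <= a -> a < b -> b <= 1 ->
  nu `]a, b]%classic = ((ln b - ln a) / L)%:E.
Proof.
move=> qa ab b1; rewrite -(top_itv qa (ltW ab) b1).
rewrite (_ : `[a, b]%classic = [set a] `|` `]a, b]%classic); last first.
  apply/seteqP; split => t /=; rewrite !in_itv/=.
    by move=> /andP[]; rewrite le_eqVlt => /predU1P[<-|->]; [left|right].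
  by move=> [->|/andP[/ltW -> ->]//]; rewrite lexx ltW.
symmetry; transitivity (nu [set a] + nu `]a, b]%classic)%E.
  by apply: measureU => //; apply/seteqP; split => // t [/= ->]; rewrite in_itv/= ltxx.
by rewrite (feasible_set1 nuF) add0e.
Qed.

Lemma top_below : nu `[0, q]%classic = 0%E.
Proof.
rewrite nuE//.
apply/eqP; rewrite eq_le measure_ge0 andbT -(constraint_set1 q01 q).
rewrite le_measure ?inE//; first exact: measurableI.
by move=> t [] /=; rewrite !in_itv/= => /andP[_ tq] /andP[qt _]; apply/eqP; rewrite eq_le tq.
Qed.

Section RiemannSum.
Context (g : R -> R) (cg : {within `[0, 1], continuous g}).

Let m01 : measurable (`[0, 1]%classic : set (measurableTypeR R)).
Proof. exact: measurable_itv. Qed.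

Lemma integrable_continuous01 (A : set (measurableTypeR R)) : measurable A -> A `<=` `[0, 1]%classic ->
  nu.-integrable A (EFin \o g).
Proof.
move=> mA A01; apply: (integrableS m01 mA A01).
apply: measurable_bounded_integrable => //.
- by rewrite (le_lt_trans (probability_le1 _ m01))// ltry.
- by apply: subspace_continuous_measurable_fun.
have /compact_bounded[M [_ mrt]] := continuous_compact cg (@segment_compact R 0 1).
by exists M; split; rewrite ?num_real // => ? ? ? ?; exact: mrt.
Qed.

Lemma Rintegral_near_cst (A : set (measurableTypeR R)) (c e : R) : measurable A -> A `<=` `[0, 1]%classic ->
  (forall t, A t -> `|g t - c| <= e) ->
  `|\int[nu]_(t in A) g t - c * fine (nu A)| <= e * fine (nu A).
Proof.
move=> mA A01 gc.
have ig := integrable_continuous01 mA A01.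
have icst (r : R) : nu.-integrable A (EFin \o cst r).
  by apply: finite_measure_integrable_cst.
rewrite -(Rintegral_cst nu mA c) -RintegralB//; last exact: icst.
have idiff : nu.-integrable A (EFin \o (fun t => g t - c)).
  have := integrableB mA ig (icst c).
  by apply: eq_integrable => // t _; rewrite /= EFinB.
apply: (le_trans (le_normr_Rintegral mA idiff)).
rewrite -(Rintegral_cst nu mA e); apply: le_Rintegral => //.
- by have := integrable_norm idiff.
- exact: icst.
Qed.

(** The measure is uniform in ln t, so the points q^(j/n) cut [q,1] into n cells of equal mass
    1/n. *)
Lemma Riemann_sum_top :
  (fun n => n%:R^-1 * \sum_(j < n) g (q `^ (j%:R / n%:R))) @ \oo --> \int[nu]_(t in `[0, 1]) g t.
Proof.
apply/cvgrPdist_le => e e0.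
have e20 : 0 < e / 2 by rewrite divr_gt0.
have [M M0 gM] := continuous_affine_modulus ler01 cg e20.
near=> n.
have n0 : (0 : R) < n%:R by rewrite ltr0n; near: n; exact: nbhs_infty_gt.
(* Cells have length at most L / n, so with this n the affine modulus gives g an oscillation of at
   most e on each of them. *)
have hM : M * L / (e / 2) <= n%:R by near: n; exact: nbhs_infty_ger.
pose pt j : R := q `^ (j%:R / n%:R).
have ptE j : pt j = expR (- (j%:R / n%:R * L)).
  by rewrite /pt /powR gt_eqF// mulrN opprK.
have pt_gt0 j : 0 < pt j by rewrite ptE expR_gt0.
have ln_pt j : ln (pt j) = - (j%:R / n%:R * L) by rewrite ptE expRK.
have pt_lt j : pt j.+1 < pt j.
  by rewrite !ptE ltr_expR ltrN2 ltr_pM2r// ltr_pM2r ?invr_gt0// ltr_nat.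
have pt_le1 j : pt j <= 1.
  by rewrite ptE -expR0 ler_expR oppr_le0 mulr_ge0 ?divr_ge0// ltW.
have pt0 : pt 0%N = 1 by rewrite ptE mul0r mul0r oppr0 expR0.
have ptn : pt n = q by rewrite ptE divff ?gt_eqF// mul1r opprK lnK.
have q_pt j : (j <= n)%N -> q <= pt j.
  move=> jn; rewrite ptE -[leLHS]lnK ?posrE// ler_expR -[leLHS]opprK lerN2.
  by rewrite ler_piMl ?(ltW L_gt0)// ler_pdivrMr// mul1r ler_nat.
have cell j : (j < n)%N -> nu `]pt j.+1, pt j]%classic = (n%:R^-1)%:E.
  move=> jn; rewrite top_itv_oc ?q_pt//; congr EFin; rewrite !ln_pt -natr1.
  by field; rewrite ?oppr_eq0 (gt_eqF n0) lt_eqF// -oppr_gt0.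
have gap j : `|pt j.+1 - pt j| <= L / n%:R.
  rewrite distrC ger0_norm ?subr_ge0 ?(ltW (pt_lt _))//.
  have -> : pt j.+1 = pt j * expR (- (L / n%:R)).
    by rewrite !ptE -expRD; congr expR; rewrite -natr1; field; rewrite gt_eqF.
  have h : 1 - L / n%:R <= expR (- (L / n%:R)) := expR_ge1Dx _.
  have := pt_gt0 j; have := pt_le1 j; have : 0 <= L / n%:R by rewrite divr_ge0 ?ltW.
  nra.
(* Cells are added from the right end 1 leftwards, each sampled at its right endpoint [pt m]. *)
have partial m : (m <= n)%N ->
    `|\int[nu]_(t in `]pt m, 1]) g t - n%:R^-1 * \sum_(j < m) g (pt j)| <= m%:R * (e / n%:R).
  elim: m => [_|m IH mn].
    by rewrite pt0 set_itv_ge ?bnd_simp// Rintegral_set0 big_ord0 mulr0 subr0 normr0 mul0r.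
  have mA : measurable (`]pt m.+1, pt m]%classic : set (measurableTypeR R)) by exact: measurable_itv.
  have mB : measurable (`]pt m, 1]%classic : set (measurableTypeR R)) by exact: measurable_itv.
  have AB : `]pt m.+1, 1]%classic = `]pt m.+1, pt m]%classic `|` `]pt m, 1]%classic.
    apply/seteqP; split => t /=; rewrite !in_itv/=.
      by move=> /andP[-> ->]; rewrite andbT; have [tm|mt] := leP t (pt m); [left|right].
    move=> [/andP[-> tm]|/andP[mt ->]]; first by rewrite (le_trans tm).
    by rewrite (lt_trans (pt_lt m)).
  have sub01 (a b : R) : 0 < a -> b <= 1 -> `]a, b]%classic `<=` (`[0, 1]%classic : set R).
    by move=> a0 b1 t /=; rewrite !in_itv/= => /andP[at_ tb]; rewrite (le_trans (ltW a0) (ltW at_)) (le_trans tb).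
  have dis : [disjoint `]pt m.+1, pt m]%classic & `]pt m, 1]%classic].
    rewrite disj_set2E; apply/eqP; apply/seteqP; split => // t [] /=.
    by rewrite !in_itv/= => /andP[_ tm] /andP[mt _]; move: (lt_le_trans mt tm); rewrite ltxx.
  rewrite AB Rintegral_setU//; last first.
    rewrite -AB; apply: integrable_continuous01; first exact: measurable_itv.
    exact: sub01.
  have := @Rintegral_near_cst _ (g (pt m)) e mA (sub01 _ _ (pt_gt0 _) (pt_le1 _)) _.
  rewrite cell//=.
  have gcell t : `]pt m.+1, pt m]%classic t -> `|g t - g (pt m)| <= e.
    rewrite /= in_itv/= => /andP[t1 t2].
    apply: (le_trans (gM _ _ _ _)).
    - by rewrite (le_trans (ltW (pt_gt0 _)) (ltW t1)) (le_trans t2).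
    - by rewrite (ltW (pt_gt0 _)) pt_le1.
    have tp : `|t - pt m| <= L / n%:R.
      apply: le_trans (gap m); rewrite !ler0_norm ?subr_le0 ?(ltW (pt_lt _))//.
      by rewrite lerN2 lerD2r ltW.
    have : M * `|t - pt m| <= M * (L / n%:R) by rewrite ler_wpM2l.
    have : M * (L / n%:R) <= e / 2.
      by rewrite mulrA ler_pdivrMr// [leRHS]mulrC -ler_pdivrMr.
    lra.
  move=> /(_ gcell) h1; have h2 := IH (ltnW mn).
  rewrite big_ord_recr/= mulrDr -[m.+1%:R]natr1 mulrDl mul1r.
  rewrite (_ : _ - _ = (\int[nu]_(t in `]pt m, 1]) g t - n%:R^-1 * \sum_(j < m) g (pt j)) +
     (\int[nu]_(t in `]pt m.+1, pt m]) g t - g (pt m) / n%:R)); last by ring.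
  by rewrite (le_trans (ler_normD _ _))// lerD.
have split01 : \int[nu]_(t in `[0, 1]) g t = \int[nu]_(t in `[0, q]) g t + \int[nu]_(t in `]q, 1]) g t.
  have AB : `[0, 1]%classic = `[0, q]%classic `|` `]q, 1]%classic.
    apply/seteqP; split => t /=; rewrite !in_itv/=.
      by move=> /andP[-> ->]; rewrite andbT; have [tm|mt] := leP t q; [left|right].
    move=> [/andP[-> tm]|/andP[mt ->]]; first by rewrite (le_trans tm)// ltW.
    by rewrite (le_trans (ltW q_gt0) (ltW mt)).
  rewrite [in LHS]AB Rintegral_setU//.
  - by rewrite -AB; exact: integrable_continuous01.
  - rewrite disj_set2E; apply/eqP; apply/seteqP; split => // t [] /=.
    by rewrite !in_itv/= => /andP[_ tm] /andP[mt _]; move: (lt_le_trans mt tm); rewrite ltxx.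
have below0 : \int[nu]_(t in `[0, q]) g t = 0.
  have := @Rintegral_near_cst `[0, q]%classic (g 0) (e / 2 + M).
  rewrite top_below/= !mulr0 subr0 normr_le0 => h; apply/eqP; apply: h => //.
    by move=> t /=; rewrite !in_itv/= => /andP[-> tq]; rewrite (le_trans tq)// ltW.
  move=> t /=; rewrite in_itv/= => /andP[t0 tq].
  have t1 : t <= 1 by rewrite (le_trans tq)// ltW.
  apply: (le_trans (gM _ _ _ _)); rewrite ?lexx ?ler01 ?t0//.
  by rewrite lerD2l subr0 ger0_norm// ler_piMr.
have := partial n (leqnn _); rewrite ptn split01 below0 add0r mulrCA divff ?gt_eqF// mulr1.
exact.
Unshelve. all: by end_near. Qed.

End RiemannSum.

(** On [q,1] the kernel at q is - ln r; its mean is evaluated as a limit of averages, here (L/2)(1 -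
    1/n). *)
Lemma radial_potential_top : radial_potential nu q = (L / 2)%:E.
Proof.
pose g t := log_kernel q t.
have cg : {within `[0, 1], continuous g}.
  apply: continuous_subspaceT => t.
  apply: (@continuous_max _ _ (cst 0) (fun t => - ln (Num.max q t))); first exact: cvg_cst.
  apply: cvgN; apply: (@continuous_comp _ _ _ (fun t => Num.max q t) (@ln R)).
    by apply: (@continuous_max _ _ (cst q) id); [exact: cvg_cst|exact: cvg_id].
  by apply: continuous_ln; rewrite lt_max q_gt0.
have -> : radial_potential nu q = (\int[nu]_(t in `[0, 1]) g t)%:E.
  (* The point removed, 2, lies outside [0,1]. *)
  rewrite /radial_potential (ge0_integral_nu01 nuF.1 (feasible_set1 nuF) 2); last 2 first.
  - exact: measurable_log_kernelr.
  - by move=> r; rewrite lee_fin log_kernel_ge0.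
  rewrite (_ : `[0, 1]%classic `\ 2 = `[0, 1]%classic); last first.
    apply/seteqP; split => t /=; first by case.
    rewrite in_itv/= => t01; split => // t2; move: t01; rewrite t2; lra.
  rewrite /Rintegral fineK//; apply: integrable_fin_num; first exact: measurable_itv.
  by apply: integrable_continuous01 => //; exact: measurable_itv.
(* The kernel takes the value L j / n at the j-th Riemann node. *)
congr EFin; rewrite -(cvg_lim (@Rhausdorff R) (Riemann_sum_top cg)).
apply: (cvg_lim (@Rhausdorff R)).
have -> : L / 2 = L / 2 - L / 2 * 0 by rewrite mulr0 subr0.
have h : (fun n : nat => L / 2 - L / 2 * n%:R^-1) @ \oo --> L / 2 - L / 2 * (0 : R).
  apply: cvgB; first exact: cvg_cst.
  apply: cvgM; first exact: cvg_cst.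
  apply/cvgr0Pnorm_le => e e0; near=> n.
  have n0 : (0 : R) < n%:R by rewrite ltr0n; near: n; exact: nbhs_infty_gt.
  have en : e^-1 <= n%:R by near: n; exact: nbhs_infty_ger.
  by rewrite ger0_norm ?invr_ge0// -[leRHS]invrK lef_pV2 ?posrE ?invr_gt0.
apply: cvg_trans h; apply: near_eq_cvg; near=> n.
have n0 : (0 : R) < n%:R by rewrite ltr0n; near: n; exact: nbhs_infty_gt.
have gE (j : 'I_n) : g (q `^ (j%:R / n%:R)) = j%:R / n%:R * L.
  have j0 : 0 <= j%:R / n%:R * L by rewrite mulr_ge0 ?divr_ge0// ltW.
  rewrite /g /log_kernel /powR gt_eqF//.
  have qe : q <= expR (j%:R / n%:R * ln q).
    rewrite -[leLHS]lnK ?posrE// ler_expR -subr_ge0.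
    rewrite (_ : _ - _ = (1 - j%:R / n%:R) * L); last by ring.
    by rewrite mulr_ge0 ?(ltW L_gt0)// subr_ge0 ler_pdivrMr// mul1r ler_nat ltnW.
  by rewrite (max_r qe) expRK -mulrN max_r.
under eq_bigr do rewrite gE.
have sumj : \sum_(j < n) (j%:R : R) = n%:R * (n%:R - 1) / 2.
  elim: (n) => [|m IH]; first by rewrite big_ord0 mul0r mul0r.
  by rewrite big_ord_recr/= IH -[m.+1%:R]natr1; field.
by rewrite -mulr_suml -mulr_suml sumj; field; rewrite gt_eqF.
Unshelve. all: by end_near. Qed.

(** The angles are taken on one side of 0 because the angular law lives on [0, 2 pi]. *)
Lemma polar_near (B : set (R * R)) : open B -> B (q, 0) ->
  exists2 e : R, 0 < e <= 1 & forall r t, `|q - r| < e -> 0 <= t <= e / 2 -> B (polar (r, t)).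
Proof.
move=> oB Bq.
have cpolar : {for (q, 0), continuous (fun u : R * R => (u.1 * cos u.2, u.1 * sin u.2))}.
  have c1 : (fun u : R * R => u.1) @ nbhs (q, 0 : R) --> q by exact: cvg_fst.
  have c2 : (fun u : R * R => u.2) @ nbhs (q, 0 : R) --> (0 : R) by exact: cvg_snd.
  have ccos : (fun u : R * R => cos u.2) @ nbhs (q, 0 : R) --> cos (0 : R).
    by apply: (continuous_cvg _ _ c2); exact: continuous_cos.
  have csin : (fun u : R * R => sin u.2) @ nbhs (q, 0 : R) --> sin (0 : R).
    by apply: (continuous_cvg _ _ c2); exact: continuous_sin.
  have h1 : (fun u : R * R => u.1 * cos u.2) @ nbhs (q, 0 : R) --> q * cos 0.
    exact: (@cvgM _ _ _ (nbhs_filter _) _ _ _ _ c1 ccos).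
  have h2 : (fun u : R * R => u.1 * sin u.2) @ nbhs (q, 0 : R) --> q * sin 0.
    exact: (@cvgM _ _ _ (nbhs_filter _) _ _ _ _ c1 csin).
  exact: (cvg_pair h1 h2).
have nB : nbhs (q * cos 0, q * sin 0) B.
  by rewrite cos0 sin0 mulr1 mulr0; exact: open_nbhs_nbhs.
have /nbhs_ballP[e /= e0 eB] := cpolar _ nB.
exists (Num.min e 1); first by rewrite lt_min e0 ltr01 ge_min lexx orbT.
move=> r t; rewrite lt_min => /andP[re _] /andP[t0 te]; apply: (eB (r, t)); split => //=.
rewrite /ball/= sub0r normrN ger0_norm//; apply: (le_lt_trans te).
have : Num.min e 1 <= e by rewrite ge_min lexx.
have : 0 < Num.min e 1 by rewrite lt_min e0 ltr01.
lra.
Qed.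

(** Proportion of the circle of radius r lying in B; [circ m B] is the integral of this function
    with respect to m. *)
Let phi (B : set (R * R)) (r : measurableTypeR R) : \bar R :=
  angle_prob (xsection ((@polar R) @^-1` B) r).

Let mpolar B : open B -> measurable ((@polar R) @^-1` B : set (cplane R)).
Proof.
move=> oB; rewrite -[X in measurable X]setTI; apply: measurable_polar => //.
exact: open_measurable_plane.
Qed.

Let mphi B : open B -> measurable_fun setT (phi B).
Proof. by move=> oB; apply: measurable_fun_xsection; exact: mpolar. Qed.

Let phi_ge0 B r : (0 <= phi B r)%E. Proof. exact: measure_ge0. Qed.

Let phi_gt B (e : R) r : open B -> 0 < e <= 1 ->
  (forall r t, `|q - r| < e -> 0 <= t <= e / 2 -> B (polar (r, t))) -> `|q - r| < e ->
  ((e / 2 / (2 * pi))%:E <= phi B r)%E.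
Proof.
move=> oB /andP[e0 e1] H re; rewrite -angle_prob_itv; last by apply/andP; split; lra.
rewrite /phi le_measure ?inE//.
  by apply: measurable_xsection; exact: mpolar.
move=> t /=; rewrite in_itv/= => t0; rewrite /xsection/= inE; exact: H.
Qed.

(** Radii slightly above q carry mass of nu. *)
Lemma msupp_circ_top : msupp (circ nu) (q, 0).
Proof.
move=> B oB Bq; have [e e01 H] := polar_near oB Bq; have /andP[e0 e1] := e01.
have pi2 := @pi_ge2 R.
pose b := Num.min 1 (q + e / 2).
have qb : q < b by rewrite lt_min q_lt1/=; lra.
have b1 : b <= 1 by rewrite ge_min lexx.
have be : b <= q + e / 2 by rewrite ge_min lexx orbT.
have mI : measurable (`[q, b]%classic : set (measurableTypeR R)) by exact: measurable_itv.
apply: (@lt_le_trans _ _ ((e / 2 / (2 * pi))%:E * nu `[q, b]%classic)%E).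
  rewrite top_itv// ?(ltW qb)// -EFinM lte_fin mulr_gt0// divr_gt0//; try lra.
  by rewrite subr_gt0 ltr_ln ?posrE// (lt_trans q_gt0).
rewrite -integral_cst//; apply: (@le_trans _ _ (\int[nu]_(r in `[q, b]) phi B r)%E).
  apply: ge0_le_integral => //.
  - by move=> r _ /=; rewrite lee_fin divr_ge0// ?divr_ge0//; lra.
  - by apply: measurable_funTS; exact: mphi.
  move=> r /=; rewrite in_itv/= => /andP[qr rb]; apply: phi_gt => //.
  by rewrite ler0_norm ?subr_le0//; lra.
by apply: ge0_subset_integral => //; exact: mphi.
Qed.

(** Radii slightly below q carry mass of sigma but none of nu, which lives on [q,1]. *)
Lemma msupp_constraint_top : msupp (fun B => circ sigma B - circ nu B)%E (q, 0).
Proof.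
move=> B oB Bq; have [e e01 H] := polar_near oB Bq; have /andP[e0 e1] := e01.
have pi2 := @pi_ge2 R; have q0 := q_gt0.
pose b := Num.max (q - e / 2) (q / 2).
have bq : b < q by rewrite gt_max; apply/andP; split; lra.
have b0 : 0 < b by rewrite lt_max; apply/orP; right; lra.
have be : q - e / 2 <= b by rewrite le_max lexx.
(* Stopping short of q keeps the interval [b,b'] disjoint from [q,1]. *)
pose b' := (b + q) / 2.
have bb' : b < b' by rewrite /b'; lra.
have b'q : b' < q by rewrite /b'; lra.
pose I : set (measurableTypeR R) := `[b, b']%classic.
have mI : measurable I by exact: measurable_itv.
have -> : circ nu B = (\int[sigma]_(r in D) phi B r)%E.
  rewrite -(integral_top q01 (mphi oB) (phi_ge0 B)).
  apply: eq_measure_integral => A mA _; exact: nuE.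
have mphiB := mphi oB.
have disj : [disjoint D & I].
  rewrite disj_set2E; apply/eqP; apply/seteqP; split => // t [] /=.
  by rewrite /I/= !in_itv/= => /andP[qt _] /andP[_ tb]; move: (le_lt_trans tb (lt_le_trans b'q qt)); rewrite ltxx.
have le1 : (\int[sigma]_(r in D) phi B r + \int[sigma]_(r in I) phi B r <= circ sigma B)%E.
  rewrite -ge0_integral_setU//; last by apply: measurable_funTS.
  by apply: ge0_subset_integral => //; exact: measurableU.
have Dfin : (\int[sigma]_(r in D) phi B r)%E \is a fin_num.
  rewrite ge0_fin_numE ?integral_ge0//.
  apply: (@le_lt_trans _ _ 1%E); last exact: ltry.
  rewrite -(integral_top q01 mphiB (phi_ge0 B)); apply: integral_top_le => // r _.
  by apply: probability_le1; apply: measurable_xsection; exact: mpolar.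
have Ipos : (0 < \int[sigma]_(r in I) phi B r)%E.
  apply: (@lt_le_trans _ _ ((e / 2 / (2 * pi))%:E * sigma I)%E).
    rewrite constraint_itv ?(ltW bb')//; last by rewrite ltW// (lt_trans b'q).
    rewrite -EFinM lte_fin mulr_gt0// divr_gt0//; try lra.
    by rewrite subr_gt0 ltr_ln ?posrE// (lt_trans b0).
  rewrite -integral_cst//; apply: ge0_le_integral => //.
  - by move=> r _ /=; rewrite lee_fin divr_ge0// ?divr_ge0//; lra.
  - by apply: measurable_funTS.
  move=> r; rewrite /I/= in_itv/= => /andP[br rb]; apply: phi_gt => //.
  by rewrite ger0_norm ?subr_ge0; lra.
by rewrite sube_gt0; apply: lt_le_trans le1; rewrite lteDl.
Qed.

End TopConstraint.

(** * The external field *)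

Section RescaledWeight.
Context (R : realType) (w : R -> R) (Q : R -> \bar R)
  (w_lim : forall a b : R, 0 < a -> a < b -> b <= 1 ->
     forall e : R, 0 < e -> \forall n \near \oo,
     forall t : R, a <= t <= b ->
       (`| (- 1 / n%:R ^+ 2 * ln (w (t ^+ n)))%:E - 2%:E * Q t | < e%:E)%E).

Let w_lim_pt (t : R) : 0 < t <= 1 -> forall e : R, 0 < e -> \forall n \near \oo,
  (`| (- 1 / n%:R ^+ 2 * ln (w (t ^+ n)))%:E - 2%:E * Q t | < e%:E)%E.
Proof.
move=> /andP[t0 t1] e e0.
have := @w_lim (t / 2) 1 _ _ (lexx _) e e0.
have -> : 0 < t / 2 by lra.
have -> : t / 2 < 1 by lra.
move=> /(_ isT isT); apply: filterS => n; apply.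
by apply/andP; split; lra.
Qed.

(** An infinite value of Q would make the difference in the hypothesis on w infinite. *)
Lemma field_fin_num (t : R) : 0 < t <= 1 -> Q t \is a fin_num.
Proof.
move=> t01; have h := w_lim_pt t01 ltr01; near \oo => n.
have : (`| (- 1 / n%:R ^+ 2 * ln (w (t ^+ n)))%:E - 2%:E * Q t | < 1%:E)%E by near: n.
case: (Q t) => [r//||].
  by rewrite gt0_muley ?lte_fin.
by rewrite gt0_muleNy ?lte_fin.
Unshelve. all: by end_near. Qed.

Lemma field_cvg (t : R) : 0 < t <= 1 ->
  (fun n => - 1 / n%:R ^+ 2 * ln (w (t ^+ n))) @ \oo --> 2 * fine (Q t).
Proof.
move=> t01; apply/cvgrPdist_lt => e e0; have := w_lim_pt t01 e0.
apply: filterS => n; rewrite -[Q t](fineK (field_fin_num t01)) -EFinM -EFinB abse_EFin lte_fin.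
by rewrite distrC.
Qed.

(* Substituting n m for n in the hypothesis on w. *)
Lemma field_expn (t : R) (m : nat) : 0 < t <= 1 -> fine (Q (t ^+ m.+1)) = m.+1%:R ^+ 2 * fine (Q t).
Proof.
move=> t01; have /andP[t0 t1] := t01.
have tm01 : 0 < t ^+ m.+1 <= 1 by rewrite exprn_gt0// exprn_ile1// ltW.
have h1 := field_cvg tm01.
have h2 : (fun n => - 1 / (m.+1 * n)%N%:R ^+ 2 * ln (w (t ^+ (m.+1 * n)))) @ \oo --> 2 * fine (Q t).
  have := field_cvg t01 => /cvgrPdist_lt h; apply/cvgrPdist_lt => e e0.
  have [N _ hN] := h e e0; exists N => // n /= Nn; apply: hN => /=.
  by rewrite (leq_trans Nn)// leq_pmull.
have h3 : (fun n => m.+1%:R ^+ 2 * (- 1 / (m.+1 * n)%N%:R ^+ 2 * ln (w (t ^+ (m.+1 * n))))) @ \oo -->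
    m.+1%:R ^+ 2 * (2 * fine (Q t)).
  by apply: cvgM; [exact: cvg_cst|exact: h2].
have := cvg_lim (@Rhausdorff R) h1; rewrite (cvg_lim (@Rhausdorff R) (l := m.+1%:R ^+ 2 * (2 * fine (Q t)))).
  by move=> E; apply: (@mulfI _ 2) => //; rewrite -E; ring.
apply: cvg_trans h3; apply: near_eq_cvg; near=> n.
have n0 : n%:R != 0 :> R by rewrite pnatr_eq0 -lt0n; near: n; exact: nbhs_infty_gt.
have m0 : m.+1%:R != 0 :> R by rewrite pnatr_eq0.
rewrite natrM exprM; move: (m.+1%:R) m0 => M M0; field.
by rewrite n0 M0.
Unshelve. all: by end_near. Qed.

(** The case t = 1 of the power rule with exponent 2: Q(1) = 4 Q(1). *)
Lemma field1 : fine (Q 1) = 0.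
Proof.
have := @field_expn 1 1%N; rewrite ltr01 lexx expr1n => /(_ isT); lra.
Qed.

Context (Q_decr : exists2 delta : R, 0 < delta <= 1 &
     forall s t : R, 0 < s -> s <= t -> t <= delta -> (Q t <= Q s)%E).

Let fine_decr : exists2 delta : R, 0 < delta <= 1 &
  forall s t : R, 0 < s -> s <= t -> t <= delta -> fine (Q t) <= fine (Q s).
Proof.
have [delta /andP[d0 d1] Qd] := Q_decr; exists delta; first by rewrite d0.
move=> s t s0 st td; apply: fine_le; last exact: Qd.
- by apply: field_fin_num; rewrite (lt_le_trans s0 st) (le_trans td).
- by apply: field_fin_num; rewrite s0 (le_trans st)// (le_trans td).
Qed.

Let exp_small (t d : R) : 0 < t < 1 -> 0 < d -> exists m : nat, t ^+ m.+1 <= d.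
Proof.
move=> /andP[t0 t1] d0.
have : (fun n => t ^+ n) @ \oo --> (0 : R) by apply: cvg_expr; rewrite ger0_norm// ltW.
move=> /cvgr0Pnorm_le/(_ d d0)[N _ hN]; exists N.
have := hN N.+1 (leqnSn N); rewrite /= ger0_norm// exprn_ge0// ltW//.
Qed.

(** A power u of s falls where Q is decreasing, and there Q(u) <= Q(u^2) = 4 Q(u). *)
Let fine_field_ge0 (s : R) : 0 < s <= 1 -> 0 <= fine (Q s).
Proof.
move=> /andP[s0]; rewrite le_eqVlt => /predU1P[->|s1]; first by rewrite field1.
have [d /andP[d0 d1] Qd] := fine_decr.
have [m sm] := exp_small (introT andP (conj s0 s1)) d0.
have s01 : 0 < s <= 1 by rewrite s0 ltW.
have sm0 : 0 < s ^+ m.+1 by rewrite exprn_gt0.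
have sm1 : s ^+ m.+1 <= 1 by rewrite exprn_ile1// ltW.
have := Qd ((s ^+ m.+1) ^+ 2) (s ^+ m.+1) _ _ sm.
have -> : 0 < (s ^+ m.+1) ^+ 2 by rewrite exprn_gt0.
have -> : (s ^+ m.+1) ^+ 2 <= s ^+ m.+1 by rewrite expr2 ler_piMr// ltW.
move=> /(_ isT isT).
rewrite (@field_expn (s ^+ m.+1) 1%N); last by rewrite sm0.
rewrite field_expn//; set M : R := _ ^+ 2.
have M0 : 0 < M by rewrite /M exprn_gt0// ltr0n.
by move=> h; rewrite -(pmulr_rge0 _ M0); lra.
Qed.

Lemma field_ge0 (s : R) : 0 < s <= 1 -> (0 <= Q s)%E.
Proof. by move=> s01; rewrite -(fineK (field_fin_num s01)) lee_fin fine_field_ge0. Qed.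

(** A common power brings s and t into the interval where Q decreases; the power rule multiplies
    both values by the same factor. Powers of 1 never get there, so t = 1 is treated apart. *)
Lemma field_anti (s t : R) : 0 < s -> s <= t -> t <= 1 -> (Q t <= Q s)%E.
Proof.
move=> s0 st t1.
have t0 := lt_le_trans s0 st.
have t01 : 0 < t <= 1 by rewrite t0.
have s01 : 0 < s <= 1 by rewrite s0 (le_trans st).
rewrite -(fineK (field_fin_num s01)) -(fineK (field_fin_num t01)) lee_fin.
move: t1; rewrite le_eqVlt => /predU1P[t1|t1]; first by rewrite t1 field1 fine_field_ge0.
have [d /andP[d0 d1] Qd] := fine_decr.
have [m tm] := exp_small (introT andP (conj t0 t1)) d0.
have := Qd (s ^+ m.+1) (t ^+ m.+1) _ _ tm.
have -> : 0 < s ^+ m.+1 by rewrite exprn_gt0.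
have -> : s ^+ m.+1 <= t ^+ m.+1 by apply: lerXn2r => //; rewrite nnegrE ltW.
move=> /(_ isT isT).
rewrite !field_expn// ler_pM2l// exprn_gt0// ltr0n//.
Qed.

(** The limit at the point t = q, read along n = k; C absorbs the finitely many k before the
    threshold. *)
Lemma field_lattice (q : R) : 0 < q < 1 -> forall e : R, 0 < e -> exists2 C : R, 0 <= C &
  forall k, `|ln (w (q ^+ k)) + 2 * fine (Q q) * k%:R ^+ 2| <= e * k%:R ^+ 2 + C.
Proof.
move=> /andP[q0 q1] e e0.
have q01 : 0 < q <= 1 by rewrite q0 ltW.
have /cvgrPdist_lt/(_ e e0)[N _ hN] := field_cvg q01.
pose F k := `|ln (w (q ^+ k)) + 2 * fine (Q q) * k%:R ^+ 2|.
exists (\sum_(k < N.+1) F k) => [|k]; first by apply: sumr_ge0 => k _; exact: normr_ge0.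
have e1 : 0 <= e * k%:R ^+ 2 by rewrite mulr_ge0 ?sqr_ge0// ltW.
have [kN|Nk] := leqP k N.
  rewrite (bigD1 (Ordinal (kN : (k < N.+1)%N)))//= -/(F k).
  have : 0 <= \sum_(i < N.+1 | i != Ordinal (kN : (k < N.+1)%N)) F i.
    by apply: sumr_ge0 => i _; exact: normr_ge0.
  by move=> ?; lra.
apply: (@le_trans _ _ (e * k%:R ^+ 2)); last by rewrite lerDl sumr_ge0// => i _; exact: normr_ge0.
have k0 : (0 : R) < k%:R by rewrite ltr0n (leq_ltn_trans _ Nk).
have k20 : (0 : R) < k%:R ^+ 2 by rewrite exprn_gt0.
have := ltW (hN k (ltnW Nk)); rewrite -(ler_pM2r k20) -[X in _ * X](ger0_norm (ltW k20)) -normrM.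
by rewrite (_ : (_ - _) * _ = ln (w (q ^+ k)) + 2 * fine (Q q) * k%:R ^+ 2)//; field; rewrite gt_eqF.
Qed.

End RescaledWeight.

(** The superlevel sets at positive heights are intervals; those at other heights are the whole
    line. *)
Lemma measurable_anti01 (R : realType) (Q0 : R -> \bar R) :
  (forall r, 0 <= Q0 r)%E -> (forall r, ~~ (0 < r <= 1) -> Q0 r = 0%E) ->
  (forall s t : R, 0 < s -> s <= t -> t <= 1 -> (Q0 t <= Q0 s)%E) ->
  measurable_fun setT (Q0 : measurableTypeR R -> \bar R).
Proof.
move=> Q0_ge0 Q0_out Q0_anti.
apply: (measurability _ (ErealGenCInfty.measurableE R)) => //.
move=> _ [_ [y ->] <-]; rewrite setTI.
have [y0|y0] := leP y 0.
  rewrite (_ : _ @^-1` _ = setT)//; apply/seteqP; split => // r _ /=.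
  by rewrite in_itv/= andbT (le_trans _ (Q0_ge0 r))// lee_fin.
apply: is_interval_measurable => a b /=; rewrite !in_itv/= !andbT => ya yb c /andP[ac cb].
have in01 r : (y%:E <= Q0 r)%E -> 0 < r <= 1.
  by move=> yr; apply: contraLR yr => /Q0_out ->; rewrite -ltNge lte_fin.
have /andP[a0 a1] := in01 _ ya; have /andP[b0 b1] := in01 _ yb.
rewrite in_itv/= andbT (le_trans yb)//; apply: Q0_anti => //.
exact: lt_le_trans ac.
Qed.

Theorem theorem2p3 (R : realType) (q : R) (q01 : 0 < q < 1)
  (w : R -> R)
  (w_gt0 : forall t : R, 0 < t <= 1 -> 0 < w t)
  (w_sum : cvgn (series (fun k => q ^+ k * w (q ^+ k))))
  (p : nat -> {poly R})
  (p_size : forall n, size (p n) = n.+1)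
  (p_lead : forall n, 0 < lead_coef (p n))
  (p_orth : forall n m,
     series (fun k => (p n).[q ^+ k] * (p m).[q ^+ k] * (q ^+ k * w (q ^+ k)))
       @ \oo --> ((n == m)%:R : R))
  (x : forall n, n.-tuple R)
  (x_sorted : forall n, sorted <%R (x n))
  (x_root : forall n, all (root (p n)) (x n))
  (Q : R -> \bar R)
  (Q_adm : admissible_field Q)
  (Q_decr : exists2 delta : R, 0 < delta <= 1 &
     forall s t : R, 0 < s -> s <= t -> t <= delta -> (Q t <= Q s)%E)
  (w_lim : forall a b : R, 0 < a -> a < b -> b <= 1 ->
     forall e : R, 0 < e -> \forall n \near \oo,
     forall t : R, a <= t <= b ->
       (`| (- 1 / n%:R ^+ 2 * ln (w (t ^+ n)))%:E - 2%:E * Q t | < e%:E)%E)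
  (nu : probability (measurableTypeR R) R)
  (nu_eq : constrained_equilibrium q01 Q nu) :
  (forall c : R, equilibrium_constant q01 Q nu c ->
     (fun n => lead_coef (p n) `^ (1 / n%:R ^+ 2)) @ \oo --> expR c) /\
  (forall g : R -> R, {within `[0, 1], continuous g} ->
     (fun n => n%:R^-1 * \sum_(j < n) g (tnth (x n) j `^ (1 / n%:R)))
       @ \oo --> \int[nu]_(t in `[0, 1]) g t).
Proof.
have /andP[q_gt0 q_lt1] := q01.
have q01' : 0 < q <= 1 by rewrite q_gt0 ltW.
pose kappa := fine (Q q).
have kappa_ge0 : 0 <= kappa by rewrite fine_ge0// (field_ge0 w_lim Q_decr).
have v_gt0 k : 0 < w (q ^+ k) by rewrite w_gt0// exprn_gt0// exprn_ile1 ?ltW.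
have v_asymp := field_lattice w_lim q01.
(* Outside (0,1] Q has neither known sign nor known measurability, hence the extension by 0. *)
pose Q0 (r : R) := if 0 < r <= 1 then Q r else 0%E.
have QE r : 0 < r <= 1 -> Q r = Q0 r by rewrite /Q0 => ->.
have Q0_ge0 r : (0 <= Q0 r)%E.
  by rewrite /Q0; case: ifPn => // r01; exact: (field_ge0 w_lim Q_decr).
have Q0_anti s t : 0 < s -> s <= t -> t <= 1 -> (Q0 t <= Q0 s)%E.
  move=> s0 st t1; rewrite -!QE ?s0 ?t1 ?(lt_le_trans s0 st) ?(le_trans st t1)//.
  exact: (field_anti w_lim Q_decr).
have mQ0 : measurable_fun setT (Q0 : measurableTypeR R -> \bar R).
  by apply: measurable_anti01 => // r; rewrite /Q0 => /negbTE ->.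
have Q0q : Q0 q = kappa%:E by rewrite -QE// /kappa fineK// (field_fin_num w_lim).
have nuE := constrained_equilibriumE mQ0 Q0_ge0 QE Q0_anti Q0q nu_eq.
have nuF := nu_eq.1.
split => [c [c_ge c_le]|g cg].
  (* Both variational inequalities apply at |z| = q, which determines c. *)
  have -> : c = kappa + - ln q / 2.
    have cq : cabs (q, 0 : R) = q.
      by rewrite /cabs/= expr0n addr0 sqrtr_sqr ger0_norm// ltW.
    have U : (log_potential (circ nu) (q, 0%R) + Q (cabs (q, 0%R)) = (kappa + - ln q / 2)%:E)%E.
      rewrite (log_potential_circ nuF.1 (feasible_set1 nuF)); last by rewrite cq ltW.
      by rewrite cq (radial_potential_top nuF nuE) QE// Q0q -EFinD addrC.
    have := c_ge _ (msupp_constraint_top nuE); have := c_le _ (msupp_circ_top nuE).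
    by rewrite U !lee_fin => h1 h2; apply/eqP; rewrite eq_le h1 h2.
  exact: (lead_coef_root_cvg q01 v_gt0 w_sum p_size p_lead p_orth kappa_ge0 v_asymp x_sorted x_root).
have h1 := zeros_average q01 v_gt0 w_sum p_size p_lead p_orth kappa_ge0 v_asymp x_sorted x_root cg.
have := @cvgD _ _ _ _ (eventually_filter) _ _ _ _ h1 (Riemann_sum_top nuF nuE cg); rewrite add0r.
apply: cvg_trans; apply: near_eq_cvg; near=> n.
by rewrite !fctE subrK.
Unshelve. all: by end_near. Qed.
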